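(* Let $\phi_1,\phi_2$ be linear fractional self maps of the unit disc with real coefficients and let $p,q$ be meromorphic functions in $\mathbb{D}$ such that for every $z\in\mathbb{D}$ $$\Re\left[\frac{p(z)\phi_2(z)+q(z)}{p(z)\phi_1(z)+q(z)}\right]^{1/2}>0,$$ and such that for every $(t,z)\in(0,1)\times\mathbb{D}$ $$|\phi_1(z)\phi_2(z)p(z)+(\phi_1(z)+t[S_z])q(z)|<|(\phi_2(z)-t[S_z])p(z)+q(z)|.$$ Let $\mathcal{X}$ be a Banach space of analytic functions in $\mathbb{D}$ for which there are constants $c=c(\mathcal{X})<1$ and $C=C(\mathcal{X})>0$ such that $|f(z)|\le C(1-|z|)^{-c}\|f\|_{\mathcal{X}}$ for all $f\in\mathcal{X}$ and $z\in\mathbb{D}$. Then for every $f\in\mathcal{X}$ and $z\in\mathbb{D}$, $$\mathcal{I}(f)(z)=\int_0^1 T_t(f)(z)\,dt,\qquad\text{where } T_t(f)(z)=w(t,z)f(\gamma(t,z)).$$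
   Context: $\mathbb{D}$ is the open unit disc in $\mathbb{C}$. A linear fractional self map of the unit disc with real coefficients is a map $\phi(z)=(az+b)/(cz+d)$ with $a,b,c,d\in\mathbb{R}$, analytic in $\mathbb{D}$, which is either nonconstant with $\phi(\mathbb{D})\subset\mathbb{D}$ or a constant in $[-1,1]$. It is assumed that $\phi_1\not\equiv\phi_2$. $S_z=[\phi_1(z),\phi_2(z)]$ is the straight line segment from $\phi_1(z)$ to $\phi_2(z)$ and $[S_z]=\phi_2(z)-\phi_1(z)$. The operator $\mathcal{I}$ is $$\mathcal{I}(f)(z)=\frac{1}{[S_z]}\int_{S_z}\frac{f(\zeta)}{p(z)\zeta+q(z)}\,d\zeta=\int_0^1\frac{f(r_z(t))}{p(z)r_z(t)+q(z)}\,dt,\qquad r_z(t)=\phi_1(z)+t[S_z],$$ the last formula being the definition at points where $[S_z]=0$. For $(t,z)\in(0,1)\times\mathbb{D}$, $$w(t,z)=\frac{1}{(\phi_2(z)-t[S_z])p(z)+q(z)},\qquad \gamma(t,z)=\frac{\phi_1(z)\phi_2(z)p(z)+(\phi_1(z)+t[S_z])q(z)}{(\phi_2(z)-t[S_z])p(z)+q(z)}.$$ The square root is the principal branch, so the first hypothesis says that at each $z$ the quotient is a well-defined complex number not in $(-\infty,0]$; in particular its denominator is nonzero. At a point $z_0$ where $p$ or $q$ has a pole, all these expressions and inequalities are understood after multiplying numerator and denominator (respectively both sides) by the least power of $(z-z_0)$ that removes the poles of $p$ and $q$ at $z_0$. *)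

(* Defs.v *)
From Stdlib Require Import Reals Lra Lia Psatz ClassicalEpsilon Arith Wf_nat.
From Coquelicot Require Export Coquelicot.
Open Scope R_scope.

Definition in_disc (z : C) : Prop := Cmod z < 1.

(** ** Analytic and meromorphic functions

    Functions are total on [C]; only their values on the disc (for a meromorphic
    function, on the disc minus its poles) are ever constrained or used. *)

Definition analytic_at (f : C -> C) (z0 : C) : Prop :=
  exists (r : R) (a : nat -> C), 0 < r /\
    forall z : C, Cmod (z - z0)%C < r ->
      is_pseries (K := C_AbsRing) (V := C_NormedModule) a (z - z0)%C (f z).

Definition analytic_in_disc (f : C -> C) : Prop :=
  forall z, in_disc z -> analytic_at f z.

Definition pole_of_order (f : C -> C) (z0 : C) (m : nat) : Prop :=
  (0 < m)%nat /\
  exists (h : C -> C) (r : R), analytic_at h z0 /\ h z0 <> 0 /\ 0 < r /\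
    forall z : C, 0 < Cmod (z - z0)%C < r -> f z = (h z / (z - z0) ^ m)%C.

Definition meromorphic_in_disc (f : C -> C) : Prop :=
  forall z, in_disc z -> analytic_at f z \/ exists m, pole_of_order f z m.

(** ** Evaluation at poles

    [clear_exp p q z0] is the least [m] such that [(z - z0)^m] removes the poles
    of [p] and [q] at [z0]; it is [0] when neither has a pole there.
    [pval p q z0] and [qval p q z0] are the values at [z0] of
    [(z - z0)^m * p z] and [(z - z0)^m * q z], hence [p z0] and [q z0] when
    [m = 0] (see [clear_exp_analytic], [pval_analytic], [qval_analytic]). *)

Definition removes_pole (f : C -> C) (z0 : C) (m : nat) : Prop :=
  exists (h : C -> C) (r : R), analytic_at h z0 /\ 0 < r /\
    forall z : C, 0 < Cmod (z - z0)%C < r -> h z = ((z - z0) ^ m * f z)%C.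

Definition is_clear_exp (p q : C -> C) (z0 : C) (m : nat) : Prop :=
  removes_pole p z0 m /\ removes_pole q z0 m /\
  forall k, removes_pole p z0 k -> removes_pole q z0 k -> (m <= k)%nat.

Definition clear_exp (p q : C -> C) (z0 : C) : nat :=
  epsilon (inhabits 0%nat) (is_clear_exp p q z0).

Definition pval (p q : C -> C) (z0 : C) : C :=
  C_lim (fun z => ((z - z0) ^ clear_exp p q z0 * p z)%C) z0.

Definition qval (p q : C -> C) (z0 : C) : C :=
  C_lim (fun z => ((z - z0) ^ clear_exp p q z0 * q z)%C) z0.

(** The factor [(z - z0)^m] at [z = z0]: it appears in a numerator that
    contains neither [p] nor [q], and equals [1] off the poles, [0] at them. *)
Definition clear_num (p q : C -> C) (z0 : C) : C :=
  ((z0 - z0) ^ clear_exp p q z0)%C.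

(** ** Principal square root

    [sqrt |w| * exp (i * arg w / 2)] with [arg w] in [(-PI, PI]], by the
    half-angle formulas; see [Csqrt_spec]. *)
Definition Csqrt (w : C) : C :=
  (sqrt ((Cmod w + Re w) / 2),
   if Rlt_dec (Im w) 0 then - sqrt ((Cmod w - Re w) / 2)
   else sqrt ((Cmod w - Re w) / 2)).

(** ** Linear fractional self maps with real coefficients *)

Definition real_linear_fractional_self_map (phi : C -> C) : Prop :=
  (exists a b c d : R, forall z, in_disc z ->
     (RtoC c * z + RtoC d)%C <> 0 /\
     phi z = ((RtoC a * z + RtoC b) / (RtoC c * z + RtoC d))%C) /\
  (((exists z1 z2, in_disc z1 /\ in_disc z2 /\ phi z1 <> phi z2) /\
    (forall z, in_disc z -> in_disc (phi z)))
   \/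
   (exists k : R, -1 <= k <= 1 /\ forall z, in_disc z -> phi z = RtoC k)).

(** ** The operators *)

Definition seg (phi1 phi2 : C -> C) (z : C) : C := (phi2 z - phi1 z)%C.

Definition r_path (phi1 phi2 : C -> C) (z : C) (t : R) : C :=
  (phi1 z + RtoC t * seg phi1 phi2 z)%C.

Definition lin_at (p q : C -> C) (z zeta : C) : C :=
  (pval p q z * zeta + qval p q z)%C.

Definition gamma_num (phi1 phi2 p q : C -> C) (t : R) (z : C) : C :=
  (phi1 z * phi2 z * pval p q z
   + (phi1 z + RtoC t * seg phi1 phi2 z) * qval p q z)%C.

Definition gamma_den (phi1 phi2 p q : C -> C) (t : R) (z : C) : C :=
  ((phi2 z - RtoC t * seg phi1 phi2 z) * pval p q z + qval p q z)%C.

Definition gamma (phi1 phi2 p q : C -> C) (t : R) (z : C) : C :=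
  (gamma_num phi1 phi2 p q t z / gamma_den phi1 phi2 p q t z)%C.

Definition weight (phi1 phi2 p q : C -> C) (t : R) (z : C) : C :=
  (clear_num p q z / gamma_den phi1 phi2 p q t z)%C.

Definition T_op (phi1 phi2 p q : C -> C) (t : R) (f : C -> C) (z : C) : C :=
  (weight phi1 phi2 p q t z * f (gamma phi1 phi2 p q t z))%C.

(** Integrals over [(0,1)] are improper at both ends: when some [phi_j] is
    constantly [1] or [-1], the path of integration ends on the unit circle,
    where [f] is not defined. *)
Definition converges01 (g : R -> C) : Prop :=
  ex_RInt_gen (V := C_R_NormedModule) g (at_right 0) (at_left 1).

Definition integral01 (g : R -> C) : C :=
  RInt_gen (V := C_R_CompleteNormedModule) g (at_right 0) (at_left 1).

Definition I_integrand (phi1 phi2 p q f : C -> C) (z : C) (t : R) : C :=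
  (clear_num p q z * f (r_path phi1 phi2 z t)
   / lin_at p q z (r_path phi1 phi2 z t))%C.

Definition I_op (phi1 phi2 p q f : C -> C) (z : C) : C :=
  integral01 (I_integrand phi1 phi2 p q f z).

(** ** Banach spaces of analytic functions

    A complex Banach space [X] together with the linear map [ev] sending an
    element to the analytic function it is; [ev] is injective as a map into
    functions on the disc. *)
Definition analytic_function_space
    (X : CompleteNormedModule C_AbsRing) (ev : X -> C -> C) : Prop :=
  (forall f, analytic_in_disc (ev f)) /\
  (forall f g z, in_disc z -> ev (plus f g) z = (ev f z + ev g z)%C) /\
  (forall (a : C) f z, in_disc z -> ev (scal a f) z = (a * ev f z)%C) /\
  (forall f g, (forall z, in_disc z -> ev f z = ev g z) -> f = g).

(** ** Consistency of the conventions *)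

Lemma pow_n_Cpow (x : C) (n : nat) : pow_n (K := C_AbsRing) x n = Cpow x n.
Proof. induction n as [|n IH]; simpl; [reflexivity|]. now rewrite IH. Qed.

Lemma analytic_at_continuous (f : C -> C) (z0 : C) :
  analytic_at f z0 -> filterlim f (locally z0) (locally (f z0)).
Proof.
  intros (r & a & Hr & Hf).
  assert (Hf0 : f z0 = a 0%nat).
  { assert (H0 : is_pseries (K := C_AbsRing) (V := C_NormedModule) a (z0 - z0)%C (f z0)).
    { apply Hf. replace (z0 - z0)%C with (RtoC 0) by ring. now rewrite Cmod_0. }
    replace (z0 - z0)%C with (RtoC 0) in H0 by ring.
    pose proof (is_pseries_0 (K := C_AbsRing) (V := C_NormedModule) a) as H1.
    exact (filterlim_locally_unique (K := C_AbsRing) (V := C_NormedModule) _ _ _ H0 H1). }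
  set (rho := r / 2).
  assert (Hrho : 0 < rho) by (unfold rho; lra).
  assert (HM : exists M, 0 <= M /\ forall n, Cmod (a n) * rho ^ n <= M).
  { assert (H0 := Hf (z0 + RtoC rho)%C).
    replace (z0 + RtoC rho - z0)%C with (RtoC rho) in H0 by ring.
    rewrite Cmod_R, Rabs_pos_eq in H0 by lra.
    assert (H1 : rho < r) by (unfold rho; lra).
    specialize (H0 H1).
    destruct (filterlim_bounded (K := C_AbsRing) (V := C_NormedModule) _
                (ex_intro _ _ H0)) as [M HM].
    set (u := fun k : nat => (Cpow (RtoC rho) k * a k)%C).
    assert (Hu : forall n, Cmod (sum_n (G := C_AbelianMonoid) u n) <= M).
    { intros n. specialize (HM n).
      rewrite (sum_n_ext (G := C_AbelianMonoid) u
                 (fun k => scal (pow_n (K := C_AbsRing) (RtoC rho) k) (a k))).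
      - exact HM.
      - intros k. rewrite pow_n_Cpow. reflexivity. }
    assert (E : forall n, Cmod (a n) * rho ^ n = Cmod (u n)).
    { intros n. unfold u.
      rewrite Cmod_mult, Cmod_pow, Cmod_R, Rabs_pos_eq by lra. ring. }
    assert (HM0 : 0 <= M).
    { eapply Rle_trans; [apply Cmod_ge_0|apply (Hu 0%nat)]. }
    exists (2 * M). split; [lra|].
    intros n. rewrite E. destruct n as [|n].
    - pose proof (Hu 0%nat) as H2. rewrite sum_O in H2. lra.
    - pose proof (Hu n) as H2. pose proof (Hu (S n)) as H3. rewrite sum_Sn in H3.
      set (s := sum_n (G := C_AbelianMonoid) u n) in *.
      change (plus s (u (S n))) with (s + u (S n))%C in H3.
      replace (u (S n)) with ((s + u (S n)) + - s)%C by ring.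
      eapply Rle_trans; [apply Cmod_triangle|]. rewrite Cmod_opp. lra. }
  destruct HM as (M & HM0 & HM).
  assert (Key : forall z : C, Cmod (z - z0)%C <= rho / 2 ->
            Cmod (f z - f z0)%C <= 2 * M * (Cmod (z - z0)%C / rho)).
  { intros z Hz. set (u := Cmod (z - z0)%C / rho).
    assert (Hu : 0 <= u <= / 2).
    { unfold u. pose proof (Cmod_ge_0 (z - z0)%C). split.
      - apply Rmult_le_pos; [lra|]. apply Rlt_le, Rinv_0_lt_compat; lra.
      - apply Rmult_le_reg_r with rho; [lra|].
        unfold Rdiv; rewrite Rmult_assoc, Rinv_l by lra. lra. }
    assert (Hz' : Cmod (z - z0)%C < r) by (unfold rho in Hz; lra).
    specialize (Hf z Hz'). set (x := (z - z0)%C) in *.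
    set (s := sum_n (fun k : nat => scal (pow_n (K := C_AbsRing) x k) (a k))) in *.
    assert (Hterm : forall n, Cmod (scal (pow_n (K := C_AbsRing) x (S n)) (a (S n)))
                     <= M * u * (/ 2) ^ n).
    { intros n. rewrite pow_n_Cpow.
      change (scal (Cpow x (S n)) (a (S n))) with (Cmult (Cpow x (S n)) (a (S n))).
      rewrite Cmod_mult, Cmod_pow.
      replace (Cmod x) with (u * rho) by (unfold u; field; lra).
      rewrite Rpow_mult_distr.
      replace (u ^ S n * rho ^ S n * Cmod (a (S n)))
        with (Cmod (a (S n)) * rho ^ S n * (u * u ^ n)) by (simpl; ring).
      rewrite (Rmult_assoc M).
      apply Rmult_le_compat; [| |apply HM|].
      - apply Rmult_le_pos; [apply Cmod_ge_0|apply pow_le; lra].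
      - apply Rmult_le_pos; [lra|apply pow_le; lra].
      - apply Rmult_le_compat_l; [lra|]. apply pow_incr; lra. }
    assert (Hs : forall n, Cmod (s n - a 0%nat)%C <= 2 * M * u * (1 - (/ 2) ^ n)).
    { induction n as [|n IH].
      - unfold s. rewrite sum_O. simpl pow_n.
        rewrite scal_one.
        replace (a 0%nat - a 0%nat)%C with (RtoC 0) by ring.
        rewrite Cmod_0. simpl. lra.
      - unfold s. rewrite sum_Sn. fold (s n).
        replace (plus (s n) (scal (pow_n (K := C_AbsRing) x (S n)) (a (S n))) - a 0%nat)%C
          with ((s n - a 0%nat) + scal (pow_n (K := C_AbsRing) x (S n)) (a (S n)))%C
          by (change plus with Cplus; ring).
        eapply Rle_trans; [apply Cmod_triangle|].
        pose proof (Hterm n). simpl ((/ 2) ^ S n).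
        set (y := (/ 2) ^ n) in *. lra. }
    assert (Hs' : forall n, Cmod (s n - a 0%nat)%C <= 2 * M * u).
    { intros n. eapply Rle_trans; [apply Hs|].
      assert (0 <= (/ 2) ^ n) by (apply pow_le; lra).
      assert (0 <= 2 * M * u) by (apply Rmult_le_pos; lra).
      nra. }
    rewrite Hf0. apply le_epsilon. intros eps Heps.
    assert (Heps' : 0 < eps / sqrt 2).
    { apply Rdiv_lt_0_compat; [lra|]. apply Rlt_sqrt2_0. }
    assert (Hl := proj1 (filterlim_locally (F := eventually) s (f z)) Hf (mkposreal _ Heps')).
    destruct Hl as [N HN]. specialize (HN N (Nat.le_refl _)).
    apply C_NormedModule_mixin_compat2 in HN. simpl in HN.
    replace (sqrt 2 * (eps / sqrt 2)) with eps in HN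
      by (field; apply Rgt_not_eq, Rlt_sqrt2_0).
    replace (f z - a 0%nat)%C with ((s N - a 0%nat) + - (s N - f z))%C by ring.
    eapply Rle_trans; [apply Cmod_triangle|]. rewrite Cmod_opp.
    pose proof (Hs' N). change (minus (s N) (f z)) with (s N - f z)%C in HN. lra. }
  apply filterlim_locally. intros eps.
  set (d := Rmin (rho / 2) (rho * eps / (2 * (2 * M + 1)))).
  assert (Hd : 0 < d).
  { unfold d. apply Rmin_pos; [lra|]. pose proof (cond_pos eps).
    apply Rdiv_lt_0_compat; [nra|lra]. }
  assert (Hd' : 0 < d / sqrt 2).
  { apply Rdiv_lt_0_compat; [lra|]. apply Rlt_sqrt2_0. }
  exists (mkposreal _ Hd'). intros z Hz.
  apply C_NormedModule_mixin_compat2 in Hz. simpl in Hz.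
  replace (sqrt 2 * (d / sqrt 2)) with d in Hz by (field; apply Rgt_not_eq, Rlt_sqrt2_0).
  change (minus z z0) with (z - z0)%C in Hz.
  apply C_NormedModule_mixin_compat1. change (minus (f z) (f z0)) with (f z - f z0)%C.
  assert (H1 : d <= rho / 2) by apply Rmin_l.
  assert (H2 : d <= rho * eps / (2 * (2 * M + 1))) by apply Rmin_r.
  eapply Rle_lt_trans; [apply Key; lra|].
  pose proof (cond_pos eps) as He.
  apply Rle_lt_trans with (2 * M * (eps / (2 * (2 * M + 1)))).
  - apply Rmult_le_compat_l; [lra|].
    apply Rmult_le_reg_r with rho; [lra|].
    unfold Rdiv at 1. rewrite Rmult_assoc, Rinv_l, Rmult_1_r by lra.
    eapply Rle_trans; [apply Rlt_le, Hz|]. eapply Rle_trans; [exact H2|].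
    right. field. lra.
  - apply Rmult_lt_reg_r with (2 * (2 * M + 1)); [lra|].
    replace (2 * M * (eps / (2 * (2 * M + 1))) * (2 * (2 * M + 1)))
      with (2 * M * eps) by (field; lra). nra.
Qed.

Lemma C_lim_extension (g h : C -> C) (z0 : C) (r : R) :
  analytic_at h z0 -> 0 < r ->
  (forall z : C, 0 < Cmod (z - z0)%C < r -> h z = g z) ->
  C_lim g z0 = h z0.
Proof.
  intros Hh Hr E. apply is_C_lim_unique.
  apply filterlim_ext_loc with h.
  - assert (Hr' : 0 < r / sqrt 2).
    { apply Rdiv_lt_0_compat; [lra|]. apply Rlt_sqrt2_0. }
    exists (mkposreal _ Hr'). intros z Hz Hne. apply E.
    apply C_NormedModule_mixin_compat2 in Hz. simpl in Hz.
    replace (sqrt 2 * (r / sqrt 2)) with r in Hz by (field; apply Rgt_not_eq, Rlt_sqrt2_0).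
    split; [|exact Hz].
    apply Cmod_gt_0. now apply Cminus_eq_contra.
  - eapply filterlim_filter_le_1; [|apply analytic_at_continuous, Hh].
    intros P [d HP]. exists d. intros y Hy _. now apply HP.
Qed.

Lemma removes_pole_analytic (f : C -> C) (z0 : C) :
  analytic_at f z0 -> removes_pole f z0 0.
Proof.
  intros Hf. exists f, 1. split; [exact Hf|]. split; [lra|].
  intros z _. simpl. ring.
Qed.

Lemma removes_pole_of_order (f : C -> C) (z0 : C) (m : nat) :
  pole_of_order f z0 m -> removes_pole f z0 m.
Proof.
  intros (_ & h & r & Hh & _ & Hr & E). exists h, r.
  split; [exact Hh|]. split; [exact Hr|]. intros z Hz. rewrite (E z Hz).
  assert (((z - z0) ^ m)%C <> 0) by (apply Cpow_nz, Cmod_gt_0; lra).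
  field. assumption.
Qed.

Lemma removes_pole_add (f : C -> C) (z0 : C) (m k : nat) :
  removes_pole f z0 m -> removes_pole f z0 (k + m).
Proof.
  intros (h & r & (s & a & Hs & Ha) & Hr & E).
  exists (fun z => ((z - z0) ^ k * h z)%C), r. split; [|split; [exact Hr|]].
  - exists s, (PS_incr_n (V := C_NormedModule) a k). split; [exact Hs|].
    intros z Hz. rewrite <- pow_n_Cpow.
    exact (is_pseries_incr_n (K := C_AbsRing) (V := C_NormedModule) a k _ _ (Ha z Hz)).
  - intros z Hz. rewrite (E z Hz), Cpow_add_r. ring.
Qed.

Lemma clear_exp_spec (p q : C -> C) (z0 : C) :
  meromorphic_in_disc p -> meromorphic_in_disc q -> in_disc z0 ->
  is_clear_exp p q z0 (clear_exp p q z0).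
Proof.
  intros Hp Hq Hz. unfold clear_exp. apply epsilon_spec.
  assert (Hrem : forall f, meromorphic_in_disc f -> exists m, removes_pole f z0 m).
  { intros f Hf. destruct (Hf z0 Hz) as [Ha|[m Hm]].
    - exists 0%nat. now apply removes_pole_analytic.
    - exists m. now apply removes_pole_of_order. }
  destruct (Hrem p Hp) as [mp Hmp]. destruct (Hrem q Hq) as [mq Hmq].
  set (P := fun m => removes_pole p z0 m /\ removes_pole q z0 m).
  assert (HP : exists m, P m).
  { exists (mq + mp)%nat. split; [now apply removes_pole_add|].
    rewrite Nat.add_comm. now apply removes_pole_add. }
  destruct (dec_inh_nat_subset_has_unique_least_element P
              (fun n => classic (P n)) HP) as (m & ((H1 & H2) & Hmin) & _).
  exists m. split; [exact H1|]. split; [exact H2|].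
  intros k Hk1 Hk2. apply Hmin. now split.
Qed.

Lemma clear_exp_analytic (p q : C -> C) (z0 : C) :
  analytic_at p z0 -> analytic_at q z0 -> clear_exp p q z0 = 0%nat.
Proof.
  intros Hp Hq.
  assert (H : is_clear_exp p q z0 (clear_exp p q z0)).
  { unfold clear_exp. apply epsilon_spec. exists 0%nat.
    split; [now apply removes_pole_analytic|]. split; [now apply removes_pole_analytic|].
    intros; lia. }
  destruct H as (_ & _ & H).
  specialize (H 0%nat (removes_pole_analytic _ _ Hp) (removes_pole_analytic _ _ Hq)). lia.
Qed.

Lemma pval_analytic (p q : C -> C) (z0 : C) :
  analytic_at p z0 -> analytic_at q z0 -> pval p q z0 = p z0.
Proof.
  intros Hp Hq. unfold pval. rewrite (clear_exp_analytic p q z0 Hp Hq).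
  apply C_lim_extension with 1; [exact Hp|lra|]. intros z _. simpl. ring.
Qed.

Lemma qval_analytic (p q : C -> C) (z0 : C) :
  analytic_at p z0 -> analytic_at q z0 -> qval p q z0 = q z0.
Proof.
  intros Hp Hq. unfold qval. rewrite (clear_exp_analytic p q z0 Hp Hq).
  apply C_lim_extension with 1; [exact Hq|lra|]. intros z _. simpl. ring.
Qed.

Lemma Csqrt_spec (w : C) :
  (Csqrt w * Csqrt w)%C = w /\ 0 <= Re (Csqrt w) /\
  (Re (Csqrt w) = 0 -> 0 <= Im (Csqrt w)).
Proof.
  destruct w as [x y].
  pose proof (re_le_Cmod (x, y)) as Hx. pose proof (Cmod_ge_0 (x, y)) as Hm.
  pose proof (Cmod2_alt (x, y)) as H2.
  simpl Re in *. simpl Im in *.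
  unfold Csqrt. simpl Re. simpl Im.
  set (m := Cmod (x, y)) in *.
  assert (Hx' : - m <= x <= m) by (unfold Rabs in Hx; destruct (Rcase_abs x); lra).
  assert (HA : sqrt ((m + x) / 2) * sqrt ((m + x) / 2) = (m + x) / 2)
    by (apply sqrt_sqrt; lra).
  assert (HB : sqrt ((m - x) / 2) * sqrt ((m - x) / 2) = (m - x) / 2)
    by (apply sqrt_sqrt; lra).
  assert (HAB : sqrt ((m + x) / 2) * sqrt ((m - x) / 2) = Rabs y / 2).
  { rewrite <- sqrt_mult by lra.
    replace ((m + x) / 2 * ((m - x) / 2)) with (Rsqr (y / 2)) by (unfold Rsqr; nra).
    rewrite sqrt_Rsqr_abs. unfold Rdiv. rewrite Rabs_mult, (Rabs_pos_eq (/ 2)) by lra.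
    reflexivity. }
  pose proof (sqrt_pos ((m + x) / 2)) as PA. pose proof (sqrt_pos ((m - x) / 2)) as PB.
  set (A := sqrt ((m + x) / 2)) in *. set (B := sqrt ((m - x) / 2)) in *.
  destruct (Rlt_dec y 0) as [Hy|Hy].
  - rewrite Rabs_left in HAB by lra.
    split; [unfold Cmult; simpl; f_equal; nra|]. simpl. split; [exact PA|].
    intros H0. rewrite H0 in HAB. lra.
  - rewrite Rabs_pos_eq in HAB by lra.
    split; [unfold Cmult; simpl; f_equal; nra|]. simpl. split; [exact PA|].
    intros _. exact PB.
Qed.

(* Main.v *)
Require Import Defs.
From Stdlib Require Import Reals Lra Lia ClassicalEpsilon FunctionalExtensionality.
From Coquelicot Require Import Coquelicot.
Open Scope R_scope.

(** Fix [z] and write [a = phi1 z], [b = phi2 z], [L x = p z * x + q z]. Since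
    [gamma' = (b - a) L a L b / D^2] and [L gamma = L a L b / D], where [D] is
    the denominator of [gamma], both sides are [1 / (b - a)] times an integral
    of [f / L] from [a] to [b]: along the segment, and along the circular arc
    [t -> gamma t z]. The hypothesis on the root puts both open paths in a
    convex set, the disc cut by a half plane, on which [L] does not vanish; there
    [f / L] has a primitive by Goursat's lemma. When [a] or [b] lies on the
    circle the arc may be tangent to it, so that the integral along the arc need
    not converge absolutely; but by the Hardy-Littlewood argument the growth
    exponent [c < 1] makes the primitive continuous up to the circle near [a] and
    [b], so both improper integrals converge, to the same increment. *)

(** Cauchy's theorem on the closed contour made of the segment and the arc is blocked at the two
    corners: [a] and [b] may lie on the circle, where [f] is undefined. Domination along the arc
    fails as well: near a tangency [1 - |gamma|] can be of order [t^2], so the growth bound is of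
    order [t^(-2c)], integrable only for [c < 1/2]. The increment of a primitive depends on
    endpoints alone, so its boundary value may be found along radii, where the distance to the
    circle grows linearly and every [c < 1] is good enough, and then be approached along any path in
    the disc. The square root serves to choose the half plane. The points 1 and [L b / L a], the
    values of [L z / L a] at [a] and [b], subtend an angle less than pi at 0, and the direction of
    [w] bisects it; rotating that direction onto the positive axis gives both a positive real
    part. *)

(** * Limits and continuity of complex-valued maps, measured by the modulus *)

Lemma norm_C_R (z : C) : norm (V := C_R_NormedModule) z = Cmod z.
Proof.
  change (sqrt (Rabs (fst z) ^ 2 + Rabs (snd z) ^ 2) = sqrt (fst z ^ 2 + snd z ^ 2)).
  now rewrite !RPow_abs, !(Rabs_pos_eq (_ ^ 2)) by apply pow2_ge_0.
Qed.

Lemma Re_plus (x y : C) : Re (x + y) = Re x + Re y.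
Proof. reflexivity. Qed.

Lemma Cmod_sym (x y : C) : Cmod (x - y) = Cmod (y - x).
Proof. rewrite <- Cmod_opp. f_equal. ring. Qed.

(** The uniform structure of [C] is that of a product, whose balls are squares; a square and a disc
    fit into each other up to the factor [sqrt 2]. All later epsilon arguments can then be made with
    [Cmod]. *)
Lemma locally_Cmod (z : C) (P : C -> Prop) :
  locally z P <-> exists d, 0 < d /\ forall y, Cmod (y - z) < d -> P y.
Proof.
  split.
  - intros [d Hd]. exists d. split; [apply cond_pos|]. intros y Hy.
    apply Hd, C_NormedModule_mixin_compat1, Hy.
  - intros (d & Hd & HP).
    assert (Hd' : 0 < d / sqrt 2) by (apply Rdiv_lt_0_compat; [lra|apply Rlt_sqrt2_0]).
    exists (mkposreal _ Hd'). intros y Hy. apply HP.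
    apply C_NormedModule_mixin_compat2 in Hy. simpl in Hy.
    replace (sqrt 2 * (d / sqrt 2)) with d in Hy by (field; apply Rgt_not_eq, Rlt_sqrt2_0).
    exact Hy.
Qed.

Lemma filterlim_Cmod {T : Type} (F : (T -> Prop) -> Prop) {FF : Filter F} (u : T -> C) (l : C) :
  filterlim u F (locally l) <-> forall eps, 0 < eps -> F (fun x => Cmod (u x - l) < eps).
Proof.
  split.
  - intros H eps He. apply (H (fun y => Cmod (y - l) < eps)), locally_Cmod. now exists eps.
  - intros H P HP. apply locally_Cmod in HP as (d & Hd & HP).
    unfold filtermap. generalize (H d Hd). apply filter_imp. auto.
Qed.

Lemma continuous_C_pair {T : UniformSpace} (f g : T -> R) (x : T) :
  continuous f x -> continuous g x -> continuous (fun t => (f t, g t) : C) x.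
Proof.
  intros Hf Hg.
  apply (continuous_comp_2 (X := C_UniformSpace) f g (fun a b => (a, b) : C)); auto.
  apply (continuous_ext (U := C_UniformSpace) (fun p : R * R => p)).
  - now intros [].
  - apply continuous_id.
Qed.

Lemma continuous_Re {T : UniformSpace} (f : T -> C) (x : T) :
  continuous f x -> continuous (fun t => Re (f t)) x.
Proof.
  intros Hf. apply (continuous_comp (V := C_UniformSpace) f Re); [exact Hf|].
  destruct (f x). apply continuous_fst.
Qed.

Lemma continuous_Im {T : UniformSpace} (f : T -> C) (x : T) :
  continuous f x -> continuous (fun t => Im (f t)) x.
Proof.
  intros Hf. apply (continuous_comp (V := C_UniformSpace) f Im); [exact Hf|].
  destruct (f x). apply continuous_snd.
Qed.

Lemma continuous_RtoC (x : R) : continuous RtoC x.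
Proof. apply continuous_C_pair; [apply continuous_id|apply continuous_const]. Qed.

Lemma continuous_Cplus {T : UniformSpace} (f g : T -> C) (x : T) :
  continuous f x -> continuous g x -> continuous (fun t => (f t + g t)%C) x.
Proof.
  intros Hf Hg. apply continuous_C_pair.
  - apply (continuous_plus (V := R_NormedModule)); now apply continuous_Re.
  - apply (continuous_plus (V := R_NormedModule)); now apply continuous_Im.
Qed.

Lemma continuous_Cmult {T : UniformSpace} (f g : T -> C) (x : T) :
  continuous f x -> continuous g x -> continuous (fun t => (f t * g t)%C) x.
Proof.
  intros Hf Hg.
  pose proof (continuous_Re f x Hf). pose proof (continuous_Im f x Hf).
  pose proof (continuous_Re g x Hg). pose proof (continuous_Im g x Hg).
  apply continuous_C_pair.
  - apply (continuous_minus (V := R_NormedModule)); now apply (continuous_mult (K := R_AbsRing)).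
  - apply (continuous_plus (V := R_NormedModule)); now apply (continuous_mult (K := R_AbsRing)).
Qed.

Lemma continuous_Cinv {T : UniformSpace} (f : T -> C) (x : T) :
  continuous f x -> f x <> 0 -> continuous (fun t => (/ f t)%C) x.
Proof.
  intros Hf H0.
  pose proof (continuous_Re f x Hf). pose proof (continuous_Im f x Hf).
  assert (Hn : continuous (fun t => / (Re (f t) * Re (f t) + Im (f t) * Im (f t))) x).
  { apply (continuous_comp (U := T) (V := R_UniformSpace) (W := R_UniformSpace)
             (fun t => Re (f t) * Re (f t) + Im (f t) * Im (f t)) Rinv).
    - apply (continuous_plus (V := R_NormedModule)); now apply (continuous_mult (K := R_AbsRing)).
    - apply continuous_Rinv. apply Cmod_gt_0 in H0. pose proof (Cmod2_alt (f x)) as E. nra. }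
  apply (continuous_ext (U := C_UniformSpace)
    (fun t => (Re (f t) * / (Re (f t) * Re (f t) + Im (f t) * Im (f t)),
               - Im (f t) * / (Re (f t) * Re (f t) + Im (f t) * Im (f t))) : C)).
  - intros t. unfold Cinv, Re, Im. simpl.
    now rewrite !Rmult_1_r.
  - apply continuous_C_pair; apply (continuous_mult (K := R_AbsRing)); auto.
    now apply (continuous_opp (V := R_NormedModule)).
Qed.

(** * Complex differentiability *)

(* Caratheodory's form of complex differentiability. *)
Definition cdiff (f : C -> C) (z d : C) : Prop :=
  exists h : C -> C, continuous h z /\ h z = d /\
    locally z (fun y => f y = (f z + (y - z) * h y)%C).

Lemma cdiff_continuous (f : C -> C) (z d : C) : cdiff f z d -> continuous f z.
Proof.
  intros (h & Hh & _ & E).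
  apply (continuous_ext_loc (U := C_UniformSpace) f (fun y => f z + (y + - z) * h y)%C).
  - revert E. apply filter_imp. intros y Hy. now rewrite Hy.
  - apply continuous_Cplus; [apply continuous_const|].
    apply continuous_Cmult; [|exact Hh].
    apply continuous_Cplus; [apply continuous_id|apply continuous_const].
Qed.

Lemma cdiff_small_o (f : C -> C) (z d : C) : cdiff f z d ->
  forall eps, 0 < eps ->
    locally z (fun y => Cmod (f y - f z - d * (y - z)) <= eps * Cmod (y - z)).
Proof.
  intros (h & Hh & Hd & E) eps He.
  pose proof (proj1 (filterlim_Cmod _ _ _) Hh eps He) as Hl. simpl in Hl.
  generalize (filter_and _ _ E Hl). apply filter_imp. intros y [Ey Hy].
  rewrite Ey. replace (f z + (y - z) * h y - f z - d * (y - z))%C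
    with ((h y - h z) * (y - z))%C by (rewrite Hd; ring).
  rewrite Cmod_mult. apply Rmult_le_compat_r; [apply Cmod_ge_0|lra].
Qed.

Lemma cdiff_affine (k0 k1 z : C) : cdiff (fun y => k0 + k1 * y)%C z k1.
Proof.
  exists (fun _ => k1). split; [apply continuous_const|]. split; [reflexivity|].
  apply filter_forall. intros y. ring.
Qed.

Lemma cdiff_mult (f g : C -> C) (z df dg : C) :
  cdiff f z df -> cdiff g z dg ->
  cdiff (fun y => f y * g y)%C z (df * g z + f z * dg)%C.
Proof.
  intros Hf Hg. pose proof (cdiff_continuous g z dg Hg) as Cg.
  destruct Hf as (hf & Cf & Ef & Lf), Hg as (hg & Cg' & Eg & Lg).
  exists (fun y => hf y * g y + f z * hg y)%C. split; [|split].
  - apply continuous_Cplus; apply continuous_Cmult; auto. apply continuous_const.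
  - now rewrite Ef, Eg.
  - generalize (filter_and _ _ Lf Lg). apply filter_imp. intros y [E1 E2].
    rewrite E1, E2 at 1. rewrite E2. ring.
Qed.

Lemma continuous_neq_0 (f : C -> C) (z : C) :
  continuous f z -> f z <> 0 -> locally z (fun y => f y <> 0).
Proof.
  intros Hf H0. apply (Hf (fun y : C => y <> 0)), locally_Cmod. exists (Cmod (f z)).
  split; [now apply Cmod_gt_0|]. intros y Hy E. rewrite E in Hy.
  replace (0 - f z)%C with (- f z)%C in Hy by ring. rewrite Cmod_opp in Hy. lra.
Qed.

Lemma cdiff_inv (f : C -> C) (z df : C) : cdiff f z df -> f z <> 0 ->
  cdiff (fun y => / f y)%C z (- df / (f z * f z))%C.
Proof.
  intros Hf H0. pose proof (cdiff_continuous f z df Hf) as Cf.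
  pose proof (continuous_neq_0 f z Cf H0) as Hn.
  destruct Hf as (h & Ch & Eh & Lh).
  exists (fun y => (- (1) * h y) * / (f z * f y))%C. split; [|split].
  - apply continuous_Cmult; [apply continuous_Cmult; [apply continuous_const|exact Ch]|].
    apply continuous_Cinv; [apply continuous_Cmult; [apply continuous_const|exact Cf]|].
    now apply Cmult_neq_0.
  - rewrite Eh. now field.
  - generalize (filter_and _ _ Lh Hn). apply filter_imp. intros y [E1 E2].
    replace ((y - z) * (- (1) * h y * / (f z * f y)))%C
      with (- ((y - z) * h y) * / (f z * f y))%C by ring.
    replace ((y - z) * h y)%C with (f y - f z)%C by (rewrite E1; ring).
    field. now split.
Qed.

(** In Caratheodory's form the chain rule is a substitution: the quotient function of the composite
    is [hg y * hf (g y)], and points with [g y = g z] need no separate treatment. *)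
Lemma cdiff_comp (f g : C -> C) (z df dg : C) :
  cdiff f (g z) df -> cdiff g z dg -> cdiff (fun y => f (g y)) z (dg * df)%C.
Proof.
  intros Hf Hg. pose proof (cdiff_continuous g z dg Hg) as Cg.
  destruct Hf as (hf & Cf & Ef & Lf), Hg as (hg & Cg' & Eg & Lg).
  exists (fun y => hg y * hf (g y))%C. split; [|split].
  - apply continuous_Cmult; [exact Cg'|].
    now apply (continuous_comp (V := C_UniformSpace) g hf).
  - now rewrite Eg, Ef.
  - generalize (filter_and _ _ Lg (Cg _ Lf)). apply filter_imp. intros y [E1 E2].
    rewrite E2. rewrite E1 at 1. ring.
Qed.

(** The difference quotient at [z], completed by [a 1], is itself the sum of a power series, that of
    [f] with its coefficients shifted by one; hence it is continuous at [z], as Caratheodory's form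
    requires. *)
Lemma analytic_at_cdiff (f : C -> C) (z : C) :
  analytic_at f z -> exists d, cdiff f z d.
Proof.
  intros (r & a & Hr & Hf).
  assert (H00 : (z - z)%C = 0) by ring.
  assert (Hf0 : f z = a 0%nat).
  { assert (H0 := Hf z). rewrite H00, Cmod_0 in H0. specialize (H0 Hr).
    exact (filterlim_locally_unique (K := C_AbsRing) (V := C_NormedModule) _ _ _ H0
             (is_pseries_0 (K := C_AbsRing) (V := C_NormedModule) a)). }
  set (h := fun y : C => if excluded_middle_informative (y = z) then a 1%nat
                         else ((f y - f z) / (y - z))%C).
  assert (Hh : analytic_at h z).
  { exists r, (PS_decr_1 (V := C_NormedModule) a). split; [exact Hr|].
    intros y Hy. unfold h. destruct (excluded_middle_informative (y = z)) as [->|Hne].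
    - rewrite H00. exact (is_pseries_0 (K := C_AbsRing) (V := C_NormedModule)
                            (PS_decr_1 (V := C_NormedModule) a)).
    - assert (Hne' : (y - z)%C <> 0) by now apply Cminus_eq_contra.
      replace ((f y - f z) / (y - z))%C with (/ (y - z) * (f y + - a 0%nat))%C
        by (rewrite Hf0; now field).
      apply (is_pseries_decr_1 (K := C_AbsRing) (V := C_NormedModule) a (y - z)%C
               (/ (y - z))%C (f y)); [|now apply Hf].
      now apply Cinv_l. }
  exists (h z), h. split; [now apply analytic_at_continuous|]. split; [reflexivity|].
  apply filter_forall. change (forall y : C, f y = (f z + (y - z) * h y)%C).
  intros y. unfold h. destruct (excluded_middle_informative (y = z)) as [->|Hne]; [ring|].
  field. now apply Cminus_eq_contra.
Qed.

(** This link opens the fundamental theorem of calculus for [RInt] to complex primitives: paths are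
    given as functions of a complex parameter, differentiated there, and restricted to real
    parameters. *)
Lemma cdiff_is_derive (F : C -> C) (t : R) (d : C) : cdiff F (RtoC t) d ->
  is_derive (K := R_AbsRing) (V := C_R_NormedModule) (fun s => F (RtoC s)) t d.
Proof.
  intros HF. split; [apply is_linear_scal_l|].
  intros x Hx. apply (is_filter_lim_locally_unique (V := AbsRing_NormedModule R_AbsRing)) in Hx.
  rewrite <- Hx. clear x Hx.
  intros eps.
  pose proof (continuous_RtoC t _ (cdiff_small_o F _ d HF eps (cond_pos eps))) as H.
  unfold filtermap in H. revert H. apply filter_imp. intros s Hs.
  rewrite norm_C_R, scal_R_Cmult.
  change (minus s t) with (s - t). change (norm (s - t)) with (Rabs (s - t)).
  rewrite <- RtoC_minus, Cmod_R in Hs.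
  match goal with |- Cmod ?x <= _ =>
    replace x with (F s - F t - d * RtoC (s - t))%C; [exact Hs|] end.
  change (F s - F t - d * RtoC (s - t) = (F s - F t) - RtoC (s - t) * d)%C. ring.
Qed.

(** * Integrals along segments *)

(** At [a = phi1 z], [b = phi2 z] this is convertible to [r_path], so that the final theorem meets
    the integrals below by reflexivity. *)
Definition on_seg (a b : C) (t : R) : C := (a + RtoC t * (b - a))%C.

Lemma on_seg_0 (a b : C) : on_seg a b 0 = a.
Proof. unfold on_seg. ring. Qed.

Lemma on_seg_1 (a b : C) : on_seg a b 1 = b.
Proof. unfold on_seg. ring. Qed.

Definition convex_set (K : C -> Prop) : Prop :=
  forall x y t, K x -> K y -> 0 <= t <= 1 -> K (on_seg x y t).

Lemma Cmod_on_seg (x y l : C) (t r : R) : 0 <= t <= 1 ->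
  Cmod (x - l) <= r -> Cmod (y - l) <= r -> Cmod (on_seg x y t - l) <= r.
Proof.
  intros Ht Hx Hy.
  replace (on_seg x y t - l)%C with (RtoC (1 - t) * (x - l) + RtoC t * (y - l))%C
    by (unfold on_seg; rewrite RtoC_minus; ring).
  eapply Rle_trans; [apply Cmod_triangle|].
  rewrite !Cmod_mult, !Cmod_R, !Rabs_pos_eq by lra. nra.
Qed.

Lemma continuous_on_seg (a b : C) (t : R) : continuous (on_seg a b) t.
Proof.
  apply continuous_Cplus; [apply continuous_const|].
  apply continuous_Cmult; [apply continuous_RtoC|apply continuous_const].
Qed.

(** The mean is kept apart from the factor [b - a] because it remains meaningful at [a = b]: it is
    the Caratheodory quotient of the primitive built from [seg_int]. *)
Definition seg_mean (g : C -> C) (a b : C) : C :=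
  RInt (V := C_R_CompleteNormedModule) (fun t => g (on_seg a b t)) 0 1.

Definition seg_int (g : C -> C) (a b : C) : C := ((b - a) * seg_mean g a b)%C.

Definition continuous_along (g : C -> C) (a b : C) : Prop :=
  forall t, 0 <= t <= 1 -> continuous g (on_seg a b t).

Lemma ex_RInt_along (g : C -> C) (a b : C) (x y : R) :
  continuous_along g a b -> 0 <= x <= 1 -> 0 <= y <= 1 ->
  ex_RInt (V := C_R_CompleteNormedModule) (fun t => g (on_seg a b t)) x y.
Proof.
  intros Hg Hx Hy. apply ex_RInt_continuous. intros t Ht.
  apply (continuous_comp (V := C_UniformSpace) (on_seg a b) g).
  - apply continuous_on_seg.
  - apply Hg. unfold Rmin, Rmax in Ht. destruct (Rle_dec x y); lra.
Qed.

Lemma is_RInt_seg_mean (g : C -> C) (a b : C) : continuous_along g a b ->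
  is_RInt (V := C_R_CompleteNormedModule) (fun t => g (on_seg a b t)) 0 1 (seg_mean g a b).
Proof.
  intros Hg. apply (RInt_correct (V := C_R_CompleteNormedModule)).
  apply ex_RInt_along; [exact Hg|lra|lra].
Qed.

Lemma is_RInt_affine_seg (k0 k1 a b : C) :
  is_RInt (V := C_R_CompleteNormedModule) (fun t => k0 + k1 * on_seg a b t)%C 0 1
    (k0 + k1 * ((a + b) / 2))%C.
Proof.
  (* A primitive in the parameter, written as a product of two affine factors so that [cdiff_mult]
     and [cdiff_affine] differentiate it. *)
  set (F := fun T : C => ((0 + 1 * T) * ((k0 + k1 * a) + (k1 * (b - a) / 2) * T))%C).
  replace (k0 + k1 * ((a + b) / 2))%C with (minus (F (RtoC 1)) (F (RtoC 0))).
  - apply (is_RInt_derive (V := C_R_CompleteNormedModule) (fun t => F (RtoC t))).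
    + intros t _.
      replace (k0 + k1 * on_seg a b t)%C with
        (1 * ((k0 + k1 * a) + (k1 * (b - a) / 2) * RtoC t)
         + (0 + 1 * RtoC t) * (k1 * (b - a) / 2))%C
        by (unfold on_seg; field).
      apply (cdiff_is_derive F t). 
      apply (cdiff_mult (fun T => 0 + 1 * T)%C
               (fun T => (k0 + k1 * a) + (k1 * (b - a) / 2) * T)%C); apply cdiff_affine.
    + intros t _. apply continuous_Cplus; [apply continuous_const|].
      apply continuous_Cmult; [apply continuous_const|apply continuous_on_seg].
  - change (F (RtoC 1) - F (RtoC 0) = k0 + k1 * ((a + b) / 2))%C.
    unfold F. field.
Qed.

(** The mean of an affine function over a segment is its value at the midpoint, so the difference of
    the two means is the mean of an integrand bounded by [M]. *)
Lemma seg_mean_affine_bound (g : C -> C) (a b k0 k1 : C) (M : R) :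
  continuous_along g a b ->
  (forall t, 0 <= t <= 1 -> Cmod (g (on_seg a b t) - (k0 + k1 * on_seg a b t)) <= M) ->
  Cmod (seg_mean g a b - (k0 + k1 * ((a + b) / 2))) <= M.
Proof.
  intros Hg HM. rewrite <- norm_C_R. replace M with ((1 - 0) * M) by ring.
  apply (norm_RInt_le_const (V := C_R_NormedModule)
           (fun t => g (on_seg a b t) - (k0 + k1 * on_seg a b t))%C 0 1); [lra| |].
  - intros t Ht. rewrite norm_C_R. now apply HM.
  - apply (is_RInt_minus (V := C_R_NormedModule) (fun t => g (on_seg a b t))).
    + now apply is_RInt_seg_mean.
    + apply is_RInt_affine_seg.
Qed.

Lemma seg_mean_const_bound (g : C -> C) (a b k : C) (M : R) :
  continuous_along g a b ->
  (forall t, 0 <= t <= 1 -> Cmod (g (on_seg a b t) - k) <= M) ->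
  Cmod (seg_mean g a b - k) <= M.
Proof.
  intros Hg HM. replace k with (k + 0 * ((a + b) / 2))%C by ring.
  apply seg_mean_affine_bound; [exact Hg|]. intros t Ht.
  replace (k + 0 * on_seg a b t)%C with k by ring. auto.
Qed.

Lemma continuous_along_sub (g : C -> C) (a b : C) (s t : R) :
  continuous_along g a b -> 0 <= s <= 1 -> 0 <= t <= 1 ->
  continuous_along g (on_seg a b s) (on_seg a b t).
Proof.
  intros Hg Hs Ht x Hx.
  replace (on_seg (on_seg a b s) (on_seg a b t) x) with (on_seg a b (s + x * (t - s))).
  - apply Hg. nra.
  - unfold on_seg. rewrite RtoC_plus, RtoC_mult, RtoC_minus. ring.
Qed.

(** The affine substitution [x -> s + x * (t - s)] turns integrals over pieces of one segment, in
    either direction, into [RInt] between parameters. Reversal and subdivision then become swapping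
    the bounds and Chasles' relation. *)
Lemma seg_int_sub (g : C -> C) (a b : C) (s t : R) :
  continuous_along g a b -> 0 <= s <= 1 -> 0 <= t <= 1 ->
  seg_int g (on_seg a b s) (on_seg a b t) =
  ((b - a) * RInt (V := C_R_CompleteNormedModule) (fun x => g (on_seg a b x)) s t)%C.
Proof.
  intros Hg Hs Ht. unfold seg_int.
  replace (on_seg a b t - on_seg a b s)%C with ((b - a) * RtoC (t - s))%C
    by (unfold on_seg; rewrite RtoC_minus; ring).
  rewrite <- Cmult_assoc. f_equal. rewrite <- scal_R_Cmult.
  change (scal (t - s) ?x) with (scal (V := C_R_CompleteNormedModule) (t - s) x).
  unfold seg_mean. rewrite <- RInt_scal.
  - transitivity (RInt (V := C_R_CompleteNormedModule) (fun x => g (on_seg a b x))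
                    ((t - s) * 0 + s) ((t - s) * 1 + s)).
    + rewrite <- (RInt_comp_lin (V := C_R_CompleteNormedModule)).
      * apply (RInt_ext (V := C_R_CompleteNormedModule)). intros x _. do 2 f_equal.
        unfold on_seg. rewrite RtoC_plus, RtoC_mult, RtoC_minus. ring.
      * apply ex_RInt_along; [exact Hg|lra|lra].
    + f_equal; ring.
  - apply ex_RInt_along; [|lra|lra]. now apply continuous_along_sub.
Qed.

Lemma seg_int_swap (g : C -> C) (a b : C) :
  continuous_along g a b -> seg_int g b a = (- seg_int g a b)%C.
Proof.
  intros Hg. pose proof (seg_int_sub g a b 1 0 Hg) as H.
  rewrite on_seg_0, on_seg_1 in H. rewrite H by lra.
  unfold seg_int, seg_mean. rewrite <- (opp_RInt_swap (V := C_R_CompleteNormedModule)).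
  - change (opp ?x) with (- x)%C. ring.
  - apply ex_RInt_along; [exact Hg|lra|lra].
Qed.

Lemma seg_int_split (g : C -> C) (a b : C) (s : R) :
  continuous_along g a b -> 0 <= s <= 1 ->
  seg_int g a b = (seg_int g a (on_seg a b s) + seg_int g (on_seg a b s) b)%C.
Proof.
  intros Hg Hs.
  pose proof (seg_int_sub g a b 0 s Hg) as H1. rewrite on_seg_0 in H1.
  pose proof (seg_int_sub g a b s 1 Hg) as H2. rewrite on_seg_1 in H2.
  rewrite H1, H2 by lra. rewrite <- Cmult_plus_distr_l. unfold seg_int. f_equal.
  symmetry. apply (RInt_Chasles (V := C_R_CompleteNormedModule));
    apply ex_RInt_along; auto; lra.
Qed.

(** * Goursat's lemma and primitives *)

Definition tri_int (g : C -> C) (x : C * C * C) : C :=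
  let '(a, b, c) := x in (seg_int g a b + seg_int g b c + seg_int g c a)%C.

Definition in_tri (K : C -> Prop) (x : C * C * C) : Prop :=
  let '(a, b, c) := x in K a /\ K b /\ K c.

(** Bounding the three sides by one number controls both the lengths of the edges and the distance
    of the edges from the first vertex, which represents the triangle in the limit argument. *)
Definition tri_le (x : C * C * C) (D : R) : Prop :=
  let '(a, b, c) := x in Cmod (b - a) <= D /\ Cmod (c - b) <= D /\ Cmod (a - c) <= D.

Definition half (a b : C) : C := on_seg a b (/ 2).

Lemma Cmod_eq_half (x y : C) (D : R) : (RtoC 2 * x = y)%C -> Cmod y <= D -> Cmod x <= D / 2.
Proof.
  intros E H. rewrite <- E, Cmod_mult, Cmod_R, Rabs_pos_eq in H by lra. lra.
Qed.

(** Joining the midpoints cuts the triangle in four; the inner edges are run through in both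
    directions and cancel, so one of the four carries at least a quarter of the integral. The bound
    on the displacement of the first vertex is what makes the first vertices converge under
    iteration. *)
Lemma Goursat_bisect (K : C -> Prop) (g : C -> C) (x : C * C * C) :
  convex_set K -> (forall z, K z -> continuous g z) -> in_tri K x ->
  exists y, in_tri K y /\ Cmod (tri_int g x) <= 4 * Cmod (tri_int g y) /\
    forall D, tri_le x D -> tri_le y (D / 2) /\ Cmod (fst (fst y) - fst (fst x)) <= D.
Proof.
  intros HK Hg. destruct x as [[a b] c]. intros (Ha & Hb & Hc).
  assert (Hal : forall u v, K u -> K v -> continuous_along g u v).
  { intros u v Hu Hv t Ht. apply Hg. now apply HK. }
  assert (Hh : forall u v, K u -> K v -> K (half u v)).
  { intros u v Hu Hv. apply HK; auto; lra. }
  set (m1 := half a b). set (m2 := half b c). set (m3 := half c a).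
  assert (K1 : K m1) by now apply Hh.
  assert (K2 : K m2) by now apply Hh.
  assert (K3 : K m3) by now apply Hh.
  assert (E : tri_int g (a, b, c) = (tri_int g (a, m1, m3) + tri_int g (m1, b, m2)
                + tri_int g (m3, m2, c) + tri_int g (m1, m2, m3))%C).
  { simpl. rewrite (seg_int_split g a b (/ 2)), (seg_int_split g b c (/ 2)),
      (seg_int_split g c a (/ 2)) by (auto; lra).
    fold (half a b) (half b c) (half c a). fold m1 m2 m3.
    rewrite (seg_int_swap g m1 m3), (seg_int_swap g m1 m2), (seg_int_swap g m2 m3) by auto.
    ring. }
  assert (Hd : forall D, tri_le (a, b, c) D ->
    tri_le (a, m1, m3) (D / 2) /\ tri_le (m1, b, m2) (D / 2) /\
    tri_le (m3, m2, c) (D / 2) /\ tri_le (m1, m2, m3) (D / 2) /\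
    Cmod (m1 - a) <= D / 2 /\ Cmod (m3 - a) <= D / 2 /\ 0 <= D).
  { intros D (H1 & H2 & H3).
    pose proof (Cmod_ge_0 (b - a)).
    pose proof H1 as H1'. pose proof H2 as H2'. pose proof H3 as H3'.
    rewrite Cmod_sym in H1', H2', H3'. simpl.
    assert (E2 : RtoC (/ 2) = (/ 2)%C) by (apply RtoC_inv; lra).
    (* Each difference to be bounded is half of an edge of the large triangle, with one orientation
       or the other; [first] looks for the right one. *)
    let half_edge e := (apply (Cmod_eq_half _ e);
      [unfold m1, m2, m3, half, on_seg; rewrite ?E2; field|assumption]) in
    repeat split; first [ lra
      | half_edge (b - a)%C | half_edge (a - b)%C | half_edge (c - b)%C
      | half_edge (b - c)%C | half_edge (a - c)%C | half_edge (c - a)%C ]. }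
  assert (T : Cmod (tri_int g (a, b, c)) <= Cmod (tri_int g (a, m1, m3))
     + Cmod (tri_int g (m1, b, m2)) + Cmod (tri_int g (m3, m2, c)) + Cmod (tri_int g (m1, m2, m3))).
  { rewrite E. eapply Rle_trans; [apply Cmod_triangle|]. apply Rplus_le_compat_r.
    eapply Rle_trans; [apply Cmod_triangle|]. apply Rplus_le_compat_r. apply Cmod_triangle. }
  destruct (Rle_dec (Cmod (tri_int g (a, b, c))) (4 * Cmod (tri_int g (a, m1, m3)))).
  { exists (a, m1, m3). split; [simpl; tauto|]. split; [assumption|].
    intros D HD. apply Hd in HD. split; [tauto|]. simpl.
    replace (a - a)%C with (RtoC 0) by ring. rewrite Cmod_0. tauto. }
  destruct (Rle_dec (Cmod (tri_int g (a, b, c))) (4 * Cmod (tri_int g (m1, b, m2)))).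
  { exists (m1, b, m2). split; [simpl; tauto|]. split; [assumption|].
    intros D HD. apply Hd in HD. split; [tauto|]. simpl. lra. }
  destruct (Rle_dec (Cmod (tri_int g (a, b, c))) (4 * Cmod (tri_int g (m3, m2, c)))).
  { exists (m3, m2, c). split; [simpl; tauto|]. split; [assumption|].
    intros D HD. apply Hd in HD. split; [tauto|]. simpl. lra. }
  (* The three corner triangles each carry less than a quarter here, so [T] leaves more than a
     quarter to the middle one. *)
  exists (m1, m2, m3). split; [simpl; tauto|]. split; [lra|].
  intros D HD. apply Hd in HD. split; [tauto|]. simpl. lra.
Qed.

Lemma half_pow_small (M d : R) : 0 < d -> exists n, M * (/ 2) ^ n < d.
Proof.
  intros Hd. destruct (pow_lt_1_zero (/ 2) ltac:(rewrite Rabs_pos_eq; lra) (d / (Rabs M + 1)))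
    as [n Hn].
  { apply Rdiv_lt_0_compat; [lra|]. pose proof (Rabs_pos M). lra. }
  exists n. specialize (Hn n (Nat.le_refl _)).
  assert (H0 : 0 <= (/ 2) ^ n) by (apply pow_le; lra).
  rewrite Rabs_pos_eq in Hn by exact H0. pose proof (Rabs_pos M). pose proof (Rle_abs M).
  apply Rle_lt_trans with ((/ 2) ^ n * (Rabs M + 1)); [nra|].
  apply (Rmult_lt_compat_r (Rabs M + 1)) in Hn; [|lra].
  replace (d / (Rabs M + 1) * (Rabs M + 1)) with d in Hn by (field; lra). exact Hn.
Qed.

Lemma geometric_limit (u : nat -> C) (D : R) :
  (forall n, Cmod (u (S n) - u n) <= D * (/ 2) ^ n) ->
  exists l, filterlim u eventually (locally l) /\
    forall n, Cmod (u n - l) <= 2 * D * (/ 2) ^ n.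
Proof.
  intros Hu.
  assert (HD : 0 <= D).
  { specialize (Hu 0%nat). simpl in Hu. pose proof (Cmod_ge_0 (u 1%nat - u 0%nat)). lra. }
  (* The exact geometric partial sum is carried through the induction; the bound [2 * D * (/ 2) ^ n]
     alone is not inductive. *)
  assert (Hd : forall n k, Cmod (u (k + n)%nat - u n)
                 <= 2 * D * (/ 2) ^ n - 2 * D * (/ 2) ^ (k + n)).
  { intros n k. induction k as [|k IH]; simpl.
    - replace (u n - u n)%C with (RtoC 0) by ring. rewrite Cmod_0. lra.
    - replace (u (S (k + n)) - u n)%C
        with ((u (S (k + n)) - u (k + n)%nat) + (u (k + n)%nat - u n))%C by ring.
      eapply Rle_trans; [apply Cmod_triangle|]. specialize (Hu (k + n)%nat). lra. }
  assert (Hp : forall n, 0 <= (/ 2) ^ n) by (intros; apply pow_le; lra).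
  assert (Hd' : forall n m, (n <= m)%nat -> Cmod (u m - u n) <= 2 * D * (/ 2) ^ n).
  { intros n m Hm. replace m with ((m - n) + n)%nat by lia.
    eapply Rle_trans; [apply Hd|]. specialize (Hp (m - n + n)%nat). nra. }
  destruct (proj1 (filterlim_locally_cauchy (U := C_R_CompleteNormedModule)
                     (F := eventually) u)) as [l Hl].
  { intros eps. destruct (half_pow_small (4 * D) eps (cond_pos eps)) as [N HN].
    exists (fun n => (N <= n)%nat). split; [now exists N|]. intros m n Hm Hn.
    apply C_NormedModule_mixin_compat1. change (minus (u n) (u m)) with (u n - u m)%C.
    replace (u n - u m)%C with ((u n - u N) + - (u m - u N))%C by ring.
    eapply Rle_lt_trans; [apply Cmod_triangle|]. rewrite Cmod_opp.
    pose proof (Hd' N m Hm). pose proof (Hd' N n Hn). lra. }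
  exists l. split; [exact Hl|]. intros n. apply le_epsilon. intros eps He.
  destruct (proj1 (filterlim_Cmod eventually u l) Hl eps He) as [N HN].
  specialize (HN (max N n) (Nat.le_max_l _ _)).
  pose proof (Hd' n (max N n) (Nat.le_max_r _ _)).
  replace (u n - l)%C with (- (u (max N n) - u n) + (u (max N n) - l))%C by ring.
  eapply Rle_trans; [apply Cmod_triangle|]. rewrite Cmod_opp. lra.
Qed.

(** The integral of an affine function around a triangle vanishes, since [(b - a) * ((a + b) / 2)]
    is half of [b^2 - a^2] and telescopes. Only the deviation from it counts, on three edges of
    length at most [D]. *)
Lemma tri_int_affine_bound (g : C -> C) (k0 k1 : C) (x : C * C * C) (D M : R) (K : C -> Prop) :
  convex_set K -> in_tri K x -> (forall z, K z -> continuous g z) -> tri_le x D ->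
  (forall y, K y -> Cmod (y - fst (fst x)) <= D -> Cmod (g y - (k0 + k1 * y)) <= M) ->
  Cmod (tri_int g x) <= 3 * D * M.
Proof.
  intros HK. destruct x as [[a b] c]. intros (Ha & Hb & Hc) Hg (H1 & H2 & H3) HM.
  simpl in HM.
  assert (HD : 0 <= D) by (pose proof (Cmod_ge_0 (b - a)); lra).
  assert (Haa : Cmod (a - a) <= D).
  { replace (a - a)%C with (RtoC 0) by ring. now rewrite Cmod_0. }
  assert (Hca : Cmod (c - a) <= D) by now rewrite Cmod_sym.
  assert (Hs : forall u v, K u -> K v -> Cmod (u - a) <= D -> Cmod (v - a) <= D ->
            Cmod (seg_mean g u v - (k0 + k1 * ((u + v) / 2))) <= M).
  { intros u v Hu Hv Du Dv. apply seg_mean_affine_bound.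
    - intros t Ht. apply Hg. now apply HK.
    - intros t Ht. apply HM; [now apply HK|now apply Cmod_on_seg]. }
  pose proof (Hs a b Ha Hb Haa H1) as S1. pose proof (Hs b c Hb Hc H1 Hca) as S2.
  pose proof (Hs c a Hc Ha Hca Haa) as S3. simpl.
  replace (seg_int g a b + seg_int g b c + seg_int g c a)%C with
    ((b - a) * (seg_mean g a b - (k0 + k1 * ((a + b) / 2)))
     + (c - b) * (seg_mean g b c - (k0 + k1 * ((b + c) / 2)))
     + (a - c) * (seg_mean g c a - (k0 + k1 * ((c + a) / 2))))%C
    by (unfold seg_int; field).
  assert (P : forall e m : C, Cmod e <= D -> Cmod m <= M -> Cmod (e * m) <= D * M).
  { intros e m He Hm. rewrite Cmod_mult.
    apply Rmult_le_compat; auto; apply Cmod_ge_0. }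
  eapply Rle_trans; [apply Cmod_triangle|].
  eapply Rle_trans; [apply Rplus_le_compat_r, Cmod_triangle|].
  pose proof (P _ _ H1 S1). pose proof (P _ _ H2 S2). pose proof (P _ _ H3 S3). lra.
Qed.

(** After [n] bisections the integral has lost at most a factor [4^n], while differentiability at
    the limit point bounds the small integral by [eps] times the square of a size proportional to
    [2^(-n)]. The two powers cancel and [eps] remains. *)
Lemma Goursat (K : C -> Prop) (g : C -> C) (x : C * C * C) :
  closed K -> convex_set K -> (forall z, K z -> exists d, cdiff g z d) ->
  in_tri K x -> tri_int g x = 0.
Proof.
  intros Hcl HK Hdiff Hx.
  assert (Hg : forall z, K z -> continuous g z).
  { intros z Hz. destruct (Hdiff z Hz) as [d Hd]. now apply cdiff_continuous with d. }
  assert (HD : exists D, tri_le x D).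
  { destruct x as [[a b] c]. exists (Cmod (b - a) + Cmod (c - b) + Cmod (a - c)). simpl.
    pose proof (Cmod_ge_0 (b - a)). pose proof (Cmod_ge_0 (c - b)).
    pose proof (Cmod_ge_0 (a - c)). lra. }
  destruct HD as [D HD].
  assert (HD0 : 0 <= D).
  { destruct x as [[a b] c]. destruct HD as [HD _]. pose proof (Cmod_ge_0 (b - a)). lra. }
  (* The hypothesis [in_tri K x] sits inside the existential so that the chosen bisection is a total
     function and can be iterated. *)
  assert (Hstep : forall x, { y | in_tri K x -> in_tri K y /\
    Cmod (tri_int g x) <= 4 * Cmod (tri_int g y) /\
    forall D, tri_le x D -> tri_le y (D / 2) /\ Cmod (fst (fst y) - fst (fst x)) <= D }).
  { intros y. apply constructive_indefinite_description.
    destruct (classic (in_tri K y)) as [Hy|Hy]; [|exists y; tauto].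
    destruct (Goursat_bisect K g y HK Hg Hy) as [y' H]. exists y'. tauto. }
  set (s := fun n => Nat.iter n (fun y => proj1_sig (Hstep y)) x).
  assert (Hs : forall n, in_tri K (s n) /\ tri_le (s n) (D * (/ 2) ^ n) /\
                Cmod (tri_int g x) <= 4 ^ n * Cmod (tri_int g (s n))).
  { induction n as [|n (I1 & I2 & I3)].
    - simpl. rewrite Rmult_1_r, Rmult_1_l. split; [exact Hx|]. split; [exact HD|lra].
    - destruct (proj2_sig (Hstep (s n)) I1) as (J1 & J2 & J3).
      change (proj1_sig (Hstep (s n))) with (s (S n)) in J1, J2, J3.
      split; [exact J1|]. split.
      + replace (D * (/ 2) ^ S n) with (D * (/ 2) ^ n / 2) by (simpl; field). now apply J3.
      + assert (0 < 4 ^ n) by (apply pow_lt; lra). simpl (4 ^ S n). nra. }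
  assert (Hlim : forall n, Cmod (fst (fst (s (S n))) - fst (fst (s n))) <= D * (/ 2) ^ n).
  { intros n. destruct (Hs n) as (I1 & I2 & _).
    destruct (proj2_sig (Hstep (s n)) I1) as (_ & _ & J3). now apply J3. }
  destruct (geometric_limit (fun n => fst (fst (s n))) D Hlim) as (l & Hl & Hl').
  assert (HKl : K l).
  { apply (closed_filterlim (F := eventually) (fun n => fst (fst (s n))) K l Hl); [|exact Hcl].
    intros n. destruct (Hs n) as (I1 & _). destruct (s n) as [[a b] c]. apply I1. }
  destruct (Hdiff l HKl) as [d Hd].
  assert (Hsmall : forall eps, 0 < eps -> Cmod (tri_int g x) <= 9 * D * D * eps).
  { intros eps He. destruct (proj1 (locally_Cmod _ _) (cdiff_small_o g l d Hd eps He))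
      as (del & Hdel & Hlin).
    destruct (half_pow_small (3 * D) del Hdel) as [n Hn].
    destruct (Hs n) as (I1 & I2 & I3). specialize (Hl' n). simpl in Hl'.
    set (y := s n) in *. set (h := (/ 2) ^ n) in *.
    assert (Hh : 4 ^ n * (h * h) = 1).
    { unfold h. rewrite <- Rpow_mult_distr, <- Rpow_mult_distr.
      replace (4 * (/ 2 * / 2)) with 1 by field. apply pow1. }
    assert (Hh0 : 0 <= h) by (apply pow_le; lra).
    (* Points of interest lie within [D * h] of the first vertex and this within [2 * D * h] of [l],
       whence [3 * D * h]; the leading 3 counts the edges. *)
    assert (B : Cmod (tri_int g y) <= 3 * (D * h) * (eps * (3 * D * h))).
    { apply (tri_int_affine_bound g (g l - d * l)%C d y (D * h) _ K); auto.
      intros v _ Hv.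
      assert (Hvl : Cmod (v - l) <= 3 * D * h).
      { replace (v - l)%C with ((v - fst (fst y)) + (fst (fst y) - l))%C by ring.
        eapply Rle_trans; [apply Cmod_triangle|]. lra. }
      replace (g v - (g l - d * l + d * v))%C with (g v - g l - d * (v - l))%C by ring.
      eapply Rle_trans; [apply Hlin; lra|]. apply Rmult_le_compat_l; lra. }
    assert (0 < 4 ^ n) by (apply pow_lt; lra).
    apply Rle_trans with (4 ^ n * (3 * (D * h) * (eps * (3 * D * h)))); [nra|].
    replace (4 ^ n * (3 * (D * h) * (eps * (3 * D * h))))
      with (9 * D * D * eps * (4 ^ n * (h * h))) by ring.
    rewrite Hh. lra. }
  apply Cmod_eq_0. apply Rle_antisym; [|apply Cmod_ge_0].
  apply le_epsilon. intros eps He.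
  assert (HP : 0 < 9 * D * D + 1) by nra.
  eapply Rle_trans; [apply (Hsmall (eps / (9 * D * D + 1))); now apply Rdiv_lt_0_compat|].
  rewrite Rplus_0_l. apply Rmult_le_reg_r with (9 * D * D + 1); [exact HP|].
  replace (9 * D * D * (eps / (9 * D * D + 1)) * (9 * D * D + 1)) with (9 * D * D * eps)
    by (field; lra). nra.
Qed.

(* Asking for a closed convex set around any three points, rather than for
   convexity alone, spares the compactness of triangles. *)
Definition tri_exhausted (O : C -> Prop) : Prop :=
  forall a b c, O a -> O b -> O c ->
    exists K, closed K /\ convex_set K /\ (forall z, K z -> O z) /\ in_tri K (a, b, c).

(** For [y] near [z] the whole segment stays in a small disc on which [g] is almost [g z]. The same
    estimate taken at [y = z] yields the value there. *)
Lemma seg_mean_tends (O : C -> Prop) (g : C -> C) (z : C) :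
  (forall y, O y -> continuous g y) -> locally z O -> O z ->
  continuous (fun y => seg_mean g z y) z /\ seg_mean g z z = g z.
Proof.
  intros Hg Ho Hz.
  assert (H : forall eps, 0 < eps -> locally z (fun y => Cmod (seg_mean g z y - g z) <= eps)).
  { intros eps He.
    destruct (proj1 (locally_Cmod _ _)
      (filter_and _ _ Ho (proj1 (filterlim_Cmod _ _ _) (Hg z Hz) eps He))) as (d & Hd & Hloc).
    apply locally_Cmod. exists d. split; [exact Hd|]. intros y Hy.
    assert (Hzz : Cmod (z - z) <= Cmod (y - z)).
    { replace (z - z)%C with (RtoC 0) by ring. rewrite Cmod_0. apply Cmod_ge_0. }
    assert (Hs : forall t, 0 <= t <= 1 -> Cmod (on_seg z y t - z) < d).
    { intros t Ht. eapply Rle_lt_trans; [|exact Hy]. apply Cmod_on_seg; auto. apply Rle_refl. }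
    apply seg_mean_const_bound.
    - intros t Ht. apply Hg. now apply Hloc, Hs.
    - intros t Ht. left. now apply Hloc, Hs. }
  assert (E : seg_mean g z z = g z).
  { apply Ceq_minus, Cmod_eq_0, Rle_antisym; [|apply Cmod_ge_0].
    apply le_epsilon. intros eps He. rewrite Rplus_0_l.
    apply (locally_singleton _ _ (H eps He)). }
  split; [|exact E]. apply filterlim_Cmod; [typeclasses eauto|]. intros eps He.
  assert (He' : 0 < eps / 2) by lra. generalize (H _ He'). apply filter_imp.
  intros y Hy. rewrite E. lra.
Qed.

(** The primitive is the integral along the segment from [z0]; Goursat's lemma on the triangle
    [z0, x, y] gives the increments, and [seg_mean g z] is then the quotient function at [z]. The
    increments are exported too, because the boundary estimates integrate [g] along chosen
    segments. *)
Lemma primitive_exists (O : C -> Prop) (g : C -> C) (z0 : C) :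
  (forall z, O z -> locally z O) -> tri_exhausted O ->
  (forall z, O z -> exists d, cdiff g z d) -> O z0 ->
  exists G, (forall z, O z -> cdiff G z (g z)) /\
    forall x y, O x -> O y -> (G y - G x)%C = seg_int g x y.
Proof.
  intros Ho Hex Hdiff H0.
  assert (Hg : forall z, O z -> continuous g z).
  { intros z Hz. destruct (Hdiff z Hz) as [d Hd]. now apply cdiff_continuous with d. }
  assert (Hadd : forall x y, O x -> O y ->
            (seg_int g z0 y - seg_int g z0 x)%C = seg_int g x y).
  { intros x y Hx Hy. destruct (Hex z0 x y H0 Hx Hy) as (K & Hcl & HK & HKO & Ht).
    pose proof (Goursat K g (z0, x, y) Hcl HK (fun z Hz => Hdiff z (HKO z Hz)) Ht) as E.
    destruct Ht as (K0 & K1 & K2). simpl in E.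
    assert (Hal : continuous_along g z0 y).
    { intros t Ht. apply Hg, HKO. now apply HK. }
    rewrite (seg_int_swap g z0 y Hal) in E.
    replace (seg_int g x y) with (seg_int g z0 y - seg_int g z0 x
      + (seg_int g z0 x + seg_int g x y + - seg_int g z0 y))%C by ring.
    rewrite E. ring. }
  exists (seg_int g z0). split; [|exact Hadd].
  intros z Hz. destruct (seg_mean_tends O g z Hg (Ho z Hz) Hz) as [Hc E].
  exists (fun y => seg_mean g z y). split; [exact Hc|]. split; [exact E|].
  generalize (Ho z Hz). apply filter_imp. intros y Hy.
  change ((y - z) * seg_mean g z y)%C with (seg_int g z y).
  rewrite <- (Hadd z y Hz Hy). ring.
Qed.

Lemma Cmod_1_lipschitz (x y : C) : Cmod x <= Cmod y + Cmod (x - y).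
Proof.
  replace x with (y + (x - y))%C at 1 by ring. apply Cmod_triangle.
Qed.

Lemma continuous_Cmod (z : C) : continuous Cmod z.
Proof.
  apply filterlim_locally. intros eps. apply locally_Cmod. exists eps.
  split; [apply cond_pos|]. intros y Hy. apply Rabs_def1.
  - change (Cmod y - Cmod z < eps). pose proof (Cmod_1_lipschitz y z). lra.
  - change (- eps < Cmod y - Cmod z). pose proof (Cmod_1_lipschitz z y).
    rewrite Cmod_sym in Hy. lra.
Qed.

(** * The disc cut by a half plane *)

(** Allowing [al = 0] includes the uncut disc, which is what arises when the linear form [L] is
    constant. *)
Definition half_disc (al be z : C) : Prop := Cmod z < 1 /\ 0 < Re (al * z + be).

Lemma continuous_Re_affine (al be z : C) : continuous (fun z => Re (al * z + be)) z.
Proof.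
  apply continuous_Re, continuous_Cplus; [|apply continuous_const].
  apply continuous_Cmult; [apply continuous_const|apply continuous_id].
Qed.

Lemma Re_affine_pos_locally (al be z : C) :
  0 < Re (al * z + be) -> locally z (fun y => 0 < Re (al * y + be)).
Proof.
  intros Hz. apply (continuous_Re_affine al be z (fun x => 0 < x)). now apply open_gt.
Qed.

Lemma half_disc_open (al be z : C) : half_disc al be z -> locally z (half_disc al be).
Proof.
  intros [H1 H2]. apply filter_and.
  - apply (continuous_Cmod z (fun x => x < 1)). now apply open_lt.
  - now apply Re_affine_pos_locally.
Qed.

Lemma Re_on_seg (al be x y : C) (t : R) :
  Re (al * on_seg x y t + be) = (1 - t) * Re (al * x + be) + t * Re (al * y + be).
Proof.
  rewrite <- !re_scal_l. rewrite <- Re_plus. f_equal.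
  unfold on_seg. rewrite RtoC_minus. ring.
Qed.

(** Relaxing both strict inequalities to the worst values attained at the three points gives a
    closed convex set that contains them and stays inside. *)
Lemma half_disc_exhausted (al be : C) : tri_exhausted (half_disc al be).
Proof.
  intros a b c [A1 A2] [B1 B2] [C1 C2].
  set (rho := Rmax (Cmod a) (Rmax (Cmod b) (Cmod c))).
  set (m := Rmin (Re (al * a + be)) (Rmin (Re (al * b + be)) (Re (al * c + be)))).
  assert (Hrho : rho < 1) by (unfold rho; repeat apply Rmax_lub_lt; auto).
  assert (Hm : 0 < m) by (unfold m; repeat apply Rmin_glb_lt; auto).
  exists (fun z => Cmod z <= rho /\ m <= Re (al * z + be)). split; [|split; [|split]].
  - apply closed_and.
    + apply (closed_comp Cmod (fun x => x <= rho)); [|apply closed_le].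
      intros z. apply continuous_Cmod.
    + apply (closed_comp (fun z => Re (al * z + be)) (fun x => m <= x)); [|apply closed_ge].
      intros z. apply continuous_Re_affine.
  - intros x y t [X1 X2] [Y1 Y2] Ht. split.
    + replace (on_seg x y t) with (on_seg x y t - 0)%C by ring.
      apply Cmod_on_seg; [exact Ht| |]; unfold Cminus; rewrite Copp_0, Cplus_0_r; assumption.
    + rewrite Re_on_seg. nra.
  - intros z [Z1 Z2]. split; lra.
  - unfold in_tri, rho, m.
    pose proof (Rmax_l (Cmod a) (Rmax (Cmod b) (Cmod c))).
    pose proof (Rmax_r (Cmod a) (Rmax (Cmod b) (Cmod c))).
    pose proof (Rmax_l (Cmod b) (Cmod c)). pose proof (Rmax_r (Cmod b) (Cmod c)).
    pose proof (Rmin_l (Re (al * a + be)) (Rmin (Re (al * b + be)) (Re (al * c + be)))).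
    pose proof (Rmin_r (Re (al * a + be)) (Rmin (Re (al * b + be)) (Re (al * c + be)))).
    pose proof (Rmin_l (Re (al * b + be)) (Re (al * c + be))).
    pose proof (Rmin_r (Re (al * b + be)) (Re (al * c + be))).
    lra.
Qed.

(** * Boundary values of the primitive *)

Lemma exp_monotone (x y : R) : x <= y -> exp x <= exp y.
Proof. intros [H| ->]; [left; now apply exp_increasing|lra]. Qed.

Lemma Rpower_antitone (x y k : R) : 0 <= k -> 0 < x <= y -> Rpower y (- k) <= Rpower x (- k).
Proof.
  intros Hk Hxy. unfold Rpower. apply exp_monotone.
  assert (ln x <= ln y) by (apply ln_le; lra). nra.
Qed.

Lemma Rpower_small (th e : R) : 0 < th -> 0 < e ->
  exists x0, 0 < x0 /\ forall x, 0 < x <= x0 -> Rpower x th <= e.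
Proof.
  intros Hth He. exists (Rpower e (/ th)). split; [apply exp_pos|].
  intros x Hx. apply Rle_trans with (Rpower (Rpower e (/ th)) th).
  - apply Rle_Rpower_l; lra.
  - rewrite Rpower_mult, Rinv_l, Rpower_1 by lra. lra.
Qed.

Lemma is_RInt_Rpower (A s d k : R) : 0 < s -> 0 < d -> k < 1 ->
  is_RInt (fun t => A * Rpower (s + t * d) (- k)) 0 1
    (A / (d * (1 - k)) * (Rpower (s + d) (1 - k) - Rpower s (1 - k))).
Proof.
  intros Hs Hd Hk.
  set (F := fun t => A / (d * (1 - k)) * Rpower (s + t * d) (1 - k)).
  replace (A / (d * (1 - k)) * (Rpower (s + d) (1 - k) - Rpower s (1 - k)))
    with (minus (F 1) (F 0)).
  - apply (is_RInt_derive (V := R_CompleteNormedModule) F).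
    + intros t Ht. rewrite Rmin_left, Rmax_right in Ht by lra.
      assert (Hp : 0 < s + t * d) by nra.
      replace (A * Rpower (s + t * d) (- k))
        with (A / (d * (1 - k)) * ((1 - k) * (d * / (s + t * d)) * Rpower (s + t * d) (1 - k))).
      * unfold F, Rpower. auto_derive; [exact Hp|]. field. lra.
      * replace (1 - k) with (1 + - k) at 3 by ring. rewrite Rpower_plus, Rpower_1 by exact Hp.
        field. lra.
    + intros t Ht. rewrite Rmin_left, Rmax_right in Ht by lra.
      assert (Hp : 0 < s + t * d) by nra.
      apply (ex_derive_continuous (V := R_NormedModule)). unfold Rpower.
      auto_derive. exact Hp.
  - unfold F. rewrite Rmult_1_l, Rmult_0_l, Rplus_0_r.
    match goal with |- minus ?x ?y = ?v => change (x - y = v :> R) end. ring.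
Qed.

Lemma radial_seg_int_bound (g : C -> C) (z : C) (A k d : R) :
  0 <= A -> 0 < k < 1 -> 0 < d <= / 2 -> Cmod z < 1 ->
  continuous_along g z (RtoC (1 - d) * z)%C ->
  (forall t, 0 <= t <= 1 -> Cmod (g (on_seg z (RtoC (1 - d) * z) t))
     <= A * Rpower (1 - Cmod (on_seg z (RtoC (1 - d) * z) t)) (- k)) ->
  Cmod (seg_int g z (RtoC (1 - d) * z)) <= A / (1 - k) * Rpower (2 * d) (1 - k).
Proof.
  intros HA Hk Hd Hz Hc Hb. pose proof (Cmod_ge_0 z) as Hz0.
  (* On the radius, [1 - |(1 - t d) z| = (1 - |z|) (1 - t d) + t d], and [1 - t d >= 1/2], so this
     is at least [s + t * d]. Positivity of [s] keeps the comparison integral proper, and [s <= d]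
     makes the final bound independent of [z]. *)
  set (s := Rmin ((1 - Cmod z) / 2) d).
  assert (Hs : 0 < s) by (unfold s; apply Rmin_pos; lra).
  assert (Hs1 : s <= (1 - Cmod z) / 2) by apply Rmin_l.
  assert (Hs2 : s <= d) by apply Rmin_r.
  assert (Hm : Cmod (seg_mean g z (RtoC (1 - d) * z))
     <= A / (d * (1 - k)) * (Rpower (s + d) (1 - k) - Rpower s (1 - k))).
  { rewrite <- norm_C_R.
    apply (norm_RInt_le (V := C_R_NormedModule)
             (fun t => g (on_seg z (RtoC (1 - d) * z) t))
             (fun t => A * Rpower (s + t * d) (- k)) 0 1); [lra| | |].
    - intros t Ht. rewrite norm_C_R. eapply Rle_trans; [now apply Hb|].
      apply Rmult_le_compat_l; [exact HA|]. apply Rpower_antitone; [lra|].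
      replace (on_seg z (RtoC (1 - d) * z) t) with (RtoC (1 - t * d) * z)%C
        by (unfold on_seg; rewrite !RtoC_minus, RtoC_mult; ring).
      assert (0 <= t * d <= / 2) by nra.
      rewrite Cmod_mult, Cmod_R, Rabs_pos_eq by lra. nra.
    - now apply is_RInt_seg_mean.
    - apply is_RInt_Rpower; lra. }
  unfold seg_int. rewrite Cmod_mult.
  replace (RtoC (1 - d) * z - z)%C with (RtoC (- d) * z)%C
    by (rewrite RtoC_minus, RtoC_opp; ring).
  rewrite Cmod_mult, Cmod_R, Rabs_Ropp, Rabs_pos_eq by lra.
  assert (Hp : Rpower (s + d) (1 - k) <= Rpower (2 * d) (1 - k)) by (apply Rle_Rpower_l; lra).
  assert (Hp0 : 0 < Rpower s (1 - k)) by apply exp_pos.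
  pose proof (Cmod_ge_0 (seg_mean g z (RtoC (1 - d) * z))) as Hm0.
  apply Rle_trans with (d * Cmod (seg_mean g z (RtoC (1 - d) * z))).
  { apply Rmult_le_compat_r; [exact Hm0|]. nra. }
  apply Rle_trans with (d * (A / (d * (1 - k)) * (Rpower (s + d) (1 - k) - Rpower s (1 - k)))).
  { apply Rmult_le_compat_l; lra. }
  replace (d * (A / (d * (1 - k)) * (Rpower (s + d) (1 - k) - Rpower s (1 - k))))
    with (A / (1 - k) * (Rpower (s + d) (1 - k) - Rpower s (1 - k))) by (field; lra).
  apply Rmult_le_compat_l; [|lra]. apply Rdiv_le_0_compat; lra.
Qed.

(* Hardy and Littlewood: the growth of [g] makes its primitive Hoelder
   continuous up to the circle; two points at distance at most [2 d] are joined
   by going down radially by [d], across, and up again. *)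
Lemma primitive_boundary_limit (O : C -> Prop) (g G : C -> C) (a : C) (A k eta : R) :
  0 <= A -> 0 < k < 1 -> Cmod a <= 1 -> 0 < eta ->
  (forall z, O z -> continuous g z) ->
  (forall x y, O x -> O y -> (G y - G x)%C = seg_int g x y) ->
  (forall z, Cmod z < 1 -> Cmod (z - a) < eta ->
     O z /\ Cmod (g z) <= A * Rpower (1 - Cmod z) (- k)) ->
  exists l, forall eps, 0 < eps -> exists d, 0 < d /\
    forall z, Cmod z < 1 -> Cmod (z - a) < d -> Cmod (G z - l) < eps.
Proof.
  intros HA Hk Ha Heta Hg HG Hb.
  (* Each radial leg contributes [A / (1 - k)] and the crossing [A * 2], all times [(2 d)^(1 - k)].
     The condition [2 * d <= eta] keeps the detour in the region where [g] is controlled: descending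
     by at most [d] from a point within [d] of [a] stays within [2 d] of [a]. *)
  assert (Key : forall d z z', 0 < d <= / 2 -> 2 * d <= eta -> Cmod z < 1 -> Cmod z' < 1 ->
    Cmod (z - a) < d -> Cmod (z' - a) < d ->
    Cmod (G z - G z') <= 2 * (A / (1 - k) + A) * Rpower (2 * d) (1 - k)).
  { intros d z z' Hd Hd2 Hz Hz' Da Da'.
    assert (Hin : forall x, Cmod x < 1 -> Cmod (x - a) < d ->
      forall t, 0 <= t <= 1 -> Cmod (on_seg x (RtoC (1 - d) * x) t) < 1 /\
        Cmod (on_seg x (RtoC (1 - d) * x) t - a) < eta).
    { intros x Hx Hxa t Ht. pose proof (Cmod_ge_0 x). assert (0 <= t * d <= d) by nra.
      replace (on_seg x (RtoC (1 - d) * x) t) with (RtoC (1 - t * d) * x)%C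
        by (unfold on_seg; rewrite !RtoC_minus, RtoC_mult; ring). split.
      - rewrite Cmod_mult, Cmod_R, Rabs_pos_eq by lra. nra.
      - replace (RtoC (1 - t * d) * x - a)%C with ((x - a) + RtoC (- (t * d)) * x)%C
          by (rewrite RtoC_minus, RtoC_opp; ring).
        eapply Rle_lt_trans; [apply Cmod_triangle|].
        rewrite Cmod_mult, Cmod_R, Rabs_Ropp, Rabs_pos_eq by lra. nra. }
    assert (Hrad : forall x, Cmod x < 1 -> Cmod (x - a) < d ->
      O x /\ O (RtoC (1 - d) * x)%C /\
      Cmod (G (RtoC (1 - d) * x)%C - G x) <= A / (1 - k) * Rpower (2 * d) (1 - k)).
    { intros x Hx Hxa. pose proof (Hin x Hx Hxa) as Hi.
      assert (O1 : O x) by (apply Hb; [assumption|lra]).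
      assert (O2 : O (RtoC (1 - d) * x)%C).
      { specialize (Hi 1). rewrite on_seg_1 in Hi. apply Hb; apply Hi; lra. }
      split; [exact O1|]. split; [exact O2|]. rewrite HG by assumption.
      apply radial_seg_int_bound; auto.
      - intros t Ht. apply Hg, Hb; now apply Hi.
      - intros t Ht. apply Hb; now apply Hi. }
    destruct (Hrad z Hz Da) as (_ & O1 & B1). destruct (Hrad z' Hz' Da') as (_ & O2 & B2).
    set (y := (RtoC (1 - d) * z)%C) in *. set (y' := (RtoC (1 - d) * z')%C) in *.
    (* The lowered points lie in the disc of radius [1 - d], which is convex, so the crossing keeps
       distance [d] from the circle and [|g|] is at most [A * d^(-k)] on it. *)
    assert (Hy : forall x, Cmod x < 1 -> Cmod (x - a) < d ->
      Cmod (RtoC (1 - d) * x - 0) <= 1 - d /\ Cmod (RtoC (1 - d) * x - RtoC (1 - d) * a) <= d).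
    { intros x Hx Hxa. pose proof (Cmod_ge_0 x). pose proof (Cmod_ge_0 (x - a)). split.
      - replace (RtoC (1 - d) * x - 0)%C with (RtoC (1 - d) * x)%C by ring.
        rewrite Cmod_mult, Cmod_R, Rabs_pos_eq by lra. nra.
      - replace (RtoC (1 - d) * x - RtoC (1 - d) * a)%C with (RtoC (1 - d) * (x - a))%C by ring.
        rewrite Cmod_mult, Cmod_R, Rabs_pos_eq by lra. nra. }
    destruct (Hy z Hz Da) as [Y1 Y2]. destruct (Hy z' Hz' Da') as [Y1' Y2'].
    fold y in Y1, Y2. fold y' in Y1', Y2'.
    assert (Hseg : forall t, 0 <= t <= 1 ->
      O (on_seg y y' t) /\ Cmod (g (on_seg y y' t) - 0) <= A * Rpower d (- k)).
    { intros t Ht.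
      assert (S1 : Cmod (on_seg y y' t - 0) <= 1 - d) by now apply Cmod_on_seg.
      assert (S2 : Cmod (on_seg y y' t - a) < eta).
      { assert (Hya : forall x, Cmod x < 1 -> Cmod (x - a) < d ->
           Cmod (RtoC (1 - d) * x - a) <= d + d * Cmod x).
        { intros x Hx Hxa.
          replace (RtoC (1 - d) * x - a)%C with ((x - a) + RtoC (- d) * x)%C
            by (rewrite RtoC_minus, RtoC_opp; ring).
          eapply Rle_trans; [apply Cmod_triangle|].
          rewrite Cmod_mult, Cmod_R, Rabs_Ropp, Rabs_pos_eq by lra. lra. }
        pose proof (Hya z Hz Da) as V. pose proof (Hya z' Hz' Da') as V'.
        fold y in V. fold y' in V'.
        apply Rle_lt_trans with (d + d * Rmax (Cmod z) (Cmod z')).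
        - apply Cmod_on_seg; [exact Ht| |].
          + eapply Rle_trans; [exact V|]. pose proof (Rmax_l (Cmod z) (Cmod z')). nra.
          + eapply Rle_trans; [exact V'|]. pose proof (Rmax_r (Cmod z) (Cmod z')). nra.
        - assert (Rmax (Cmod z) (Cmod z') < 1) by now apply Rmax_lub_lt. nra. }
      unfold Cminus in *. rewrite Copp_0, Cplus_0_r in *.
      assert (S1' : Cmod (on_seg y y' t) < 1) by lra.
      destruct (Hb _ S1' S2) as [Ot Bt]. split; [exact Ot|].
      eapply Rle_trans; [exact Bt|]. apply Rmult_le_compat_l; [exact HA|].
      apply Rpower_antitone; lra. }
    assert (B3 : Cmod (G y' - G y) <= 2 * A * Rpower (2 * d) (1 - k)).
    { rewrite HG by assumption. unfold seg_int. rewrite Cmod_mult.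
      assert (M : Cmod (seg_mean g y y' - 0) <= A * Rpower d (- k)).
      { apply seg_mean_const_bound; intros t Ht; [apply Hg|]; now apply Hseg. }
      replace (seg_mean g y y' - 0)%C with (seg_mean g y y') in M by ring.
      assert (L : Cmod (y' - y) <= 2 * d).
      { replace (y' - y)%C with ((y' - RtoC (1 - d) * a) + - (y - RtoC (1 - d) * a))%C by ring.
        eapply Rle_trans; [apply Cmod_triangle|]. rewrite Cmod_opp. lra. }
      apply Rle_trans with (2 * d * (A * Rpower d (- k))).
      - apply Rmult_le_compat; auto; apply Cmod_ge_0.
      - replace (2 * d * (A * Rpower d (- k))) with (2 * A * (Rpower d 1 * Rpower d (- k)))
          by (rewrite Rpower_1 by lra; ring).
        rewrite <- Rpower_plus. apply Rmult_le_compat_l; [lra|].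
        apply Rle_Rpower_l; lra. }
    replace (G z - G z')%C with (- (G y - G z) + - (G y' - G y) + (G y' - G z'))%C by ring.
    eapply Rle_trans; [apply Cmod_triangle|].
    eapply Rle_trans; [apply Rplus_le_compat_r, Cmod_triangle|].
    rewrite !Cmod_opp. lra. }
  assert (Hcauchy : forall eps, 0 < eps -> exists d, 0 < d /\ forall z z',
    Cmod z < 1 -> Cmod z' < 1 -> Cmod (z - a) < d -> Cmod (z' - a) < d ->
    Cmod (G z - G z') < eps).
  { intros eps He.
    assert (HB : 0 <= A / (1 - k) + A).
    { assert (0 <= A / (1 - k)) by (apply Rdiv_le_0_compat; lra). lra. }
    set (B := A / (1 - k) + A) in *.
    destruct (Rpower_small (1 - k) (eps / (2 * B + 1))) as (x0 & Hx0 & Hsm);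
      [lra|apply Rdiv_lt_0_compat; lra|].
    set (d := Rmin (/ 2) (Rmin (eta / 2) (x0 / 2))).
    assert (D0 : 0 < d) by (unfold d; repeat apply Rmin_glb_lt; lra).
    assert (D1 : d <= / 2) by apply Rmin_l.
    assert (D2 : d <= Rmin (eta / 2) (x0 / 2)) by apply Rmin_r.
    pose proof (Rmin_l (eta / 2) (x0 / 2)). pose proof (Rmin_r (eta / 2) (x0 / 2)).
    exists d. split; [exact D0|]. intros z z' Hz Hz' Da Da'.
    eapply Rle_lt_trans; [apply (Key d); auto; lra|].
    assert (P : Rpower (2 * d) (1 - k) <= eps / (2 * B + 1)) by (apply Hsm; lra).
    apply Rle_lt_trans with (2 * B * (eps / (2 * B + 1))); [apply Rmult_le_compat_l; lra|].
    apply Rmult_lt_reg_r with (2 * B + 1); [lra|].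
    replace (2 * B * (eps / (2 * B + 1)) * (2 * B + 1)) with (2 * B * eps) by (field; lra). lra. }
  (* Neighbourhoods of [a] traced on the open disc; this filter is proper because [(1 - s) a] tends
     to [a] from inside, and completeness then gives the limit of [G]. *)
  set (F := within (fun z : C => Cmod z < 1) (locally a)).
  assert (FF : ProperFilter F).
  { apply Build_ProperFilter; [|apply within_filter; typeclasses eauto].
    intros P HP. apply locally_Cmod in HP as (d & Hd & HP).
    set (s := Rmin (/ 2) (d / 2)).
    assert (S0 : 0 < s) by (unfold s; apply Rmin_pos; lra).
    assert (S1 : s <= / 2) by apply Rmin_l. assert (S2 : s <= d / 2) by apply Rmin_r.
    pose proof (Cmod_ge_0 a).
    exists (RtoC (1 - s) * a)%C. apply HP.
    - replace (RtoC (1 - s) * a - a)%C with (RtoC (- s) * a)%C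
        by (rewrite RtoC_minus, RtoC_opp; ring).
      rewrite Cmod_mult, Cmod_R, Rabs_Ropp, Rabs_pos_eq by lra. nra.
    - rewrite Cmod_mult, Cmod_R, Rabs_pos_eq by lra. nra. }
  destruct (proj1 (filterlim_locally_cauchy (U := C_R_CompleteNormedModule) (F := F) G))
    as [l Hl].
  { intros eps. destruct (Hcauchy eps (cond_pos eps)) as (d & Hd & Hc).
    exists (fun z => Cmod z < 1 /\ Cmod (z - a) < d). split.
    - apply locally_Cmod. exists d. auto.
    - intros z z' [Z1 Z2] [Z1' Z2']. apply C_NormedModule_mixin_compat1. now apply Hc. }
  exists l. intros eps He.
  pose proof (proj1 (filterlim_Cmod F G l) Hl eps He) as H.
  apply locally_Cmod in H as (d & Hd & H). exists d. auto.
Qed.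

(** * Improper integrals along the two paths *)

Lemma at_right_0_lt_1 : at_right 0 (fun t => 0 < t < 1).
Proof.
  exists (mkposreal 1 Rlt_0_1). intros t Ht H0. split; [exact H0|].
  apply Rabs_def2 in Ht. change (minus t 0) with (t - 0) in Ht. simpl in Ht. lra.
Qed.

Lemma at_left_1_gt_0 : at_left 1 (fun t => 0 < t < 1).
Proof.
  exists (mkposreal 1 Rlt_0_1). intros t Ht H0. split; [|exact H0].
  apply Rabs_def2 in Ht. change (minus t 1) with (t - 1) in Ht. simpl in Ht. lra.
Qed.

(** The fundamental theorem applies on each compact subinterval and the two ends are passed to the
    limit separately. The given integrand [h] is compared with the continuous [f] only on the open
    interval, as its end values may involve [f] outside its domain. *)
Lemma is_RInt_gen_01 (F : C -> C) (f h : R -> C) (la lb : C) :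
  (forall t, 0 < t < 1 -> cdiff F (RtoC t) (f t)) ->
  (forall t, 0 < t < 1 -> continuous f t) ->
  (forall t, 0 < t < 1 -> f t = h t) ->
  filterlim (fun t => F (RtoC t)) (at_right 0) (locally la) ->
  filterlim (fun t => F (RtoC t)) (at_left 1) (locally lb) ->
  is_RInt_gen (V := C_R_CompleteNormedModule) h (at_right 0) (at_left 1) (lb - la)%C.
Proof.
  intros HF Hf Hfh Ha Hb P HP. apply locally_Cmod in HP as (d & Hd & HP).
  assert (Hd2 : 0 < d / 2) by lra.
  pose proof (proj1 (filterlim_Cmod _ _ _) Ha _ Hd2) as Ha'.
  pose proof (proj1 (filterlim_Cmod _ _ _) Hb _ Hd2) as Hb'.
  apply Filter_prod with
    (Q := fun t => Cmod (F (RtoC t) - la) < d / 2 /\ 0 < t < 1)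
    (R := fun t => Cmod (F (RtoC t) - lb) < d / 2 /\ 0 < t < 1).
  - apply filter_and; [exact Ha'|exact at_right_0_lt_1].
  - apply filter_and; [exact Hb'|exact at_left_1_gt_0].
  - intros x y [X1 X2] [Y1 Y2]. simpl. exists (F (RtoC y) - F (RtoC x))%C. split.
    + assert (Hin : forall t, Rmin x y <= t <= Rmax x y -> 0 < t < 1).
      { intros t Ht. unfold Rmin, Rmax in Ht. destruct (Rle_dec x y); lra. }
      apply (is_RInt_ext (V := C_R_CompleteNormedModule) f).
      { intros t Ht. apply Hfh, Hin. lra. }
      apply (is_RInt_derive (V := C_R_CompleteNormedModule) (fun t => F (RtoC t)) f).
      * intros t Ht. apply cdiff_is_derive, HF, Hin, Ht.
      * intros t Ht. apply Hf, Hin, Ht.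
    + apply HP.
      replace (F (RtoC y) - F (RtoC x) - (lb - la))%C
        with ((F (RtoC y) - lb) + - (F (RtoC x) - la))%C by ring.
      eapply Rle_lt_trans; [apply Cmod_triangle|]. rewrite Cmod_opp. lra.
Qed.

Lemma is_RInt_gen_01_const (h : R -> C) (k : C) :
  (forall t, 0 < t < 1 -> h t = k) ->
  is_RInt_gen (V := C_R_CompleteNormedModule) h (at_right 0) (at_left 1) k.
Proof.
  intros Hh.
  assert (Hc : forall x : R, continuous (fun t => (0 + k * RtoC t)%C) x).
  { intros x. apply continuous_Cplus; [apply continuous_const|].
    apply continuous_Cmult; [apply continuous_const|apply continuous_RtoC]. }
  replace k with ((0 + k * RtoC 1) - (0 + k * RtoC 0))%C at 1 by ring.
  apply is_RInt_gen_01 with (F := fun T => (0 + k * T)%C) (f := fun _ => k).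
  - intros t _. apply cdiff_affine.
  - intros t _. apply continuous_const.
  - intros t Ht. now rewrite Hh.
  - eapply filterlim_filter_le_1; [apply filter_le_within|apply (Hc 0)].
  - eapply filterlim_filter_le_1; [apply filter_le_within|apply (Hc 1)].
Qed.

(** The limit of [G] at [a] is unrestricted within the disc, so the way the path approaches [a],
    tangentially or not, does not matter. *)
Lemma primitive_path_limit (G : C -> C) (u : R -> C) (F : (R -> Prop) -> Prop) {FF : Filter F}
  (a l : C) :
  (forall eps, 0 < eps -> exists d, 0 < d /\
     forall z, Cmod z < 1 -> Cmod (z - a) < d -> Cmod (G z - l) < eps) ->
  F (fun t => Cmod (u t) < 1) -> filterlim u F (locally a) ->
  filterlim (fun t => G (u t)) F (locally l).
Proof.
  intros HG H1 Hu. apply filterlim_Cmod; [exact FF|]. intros eps He.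
  destruct (HG eps He) as (d & Hd & H).
  generalize (filter_and _ _ H1 (proj1 (filterlim_Cmod F u a) Hu d Hd)).
  apply filter_imp. intros t [T1 T2]. now apply H.
Qed.

(** The value is expressed through the boundary limits of [G] at the end points alone. Two paths
    with common ends and the same factor [k], here [/ (b - a)], therefore receive literally the same
    value. The path is smooth up to its ends but needs to lie in [O] only in between. *)
Lemma path_integral (O : C -> Prop) (g G : C -> C) (U V : C -> C) (k la lb : C) (h : R -> C) :
  (forall z, O z -> Cmod z < 1) ->
  (forall z, O z -> continuous g z) -> (forall z, O z -> cdiff G z (g z)) ->
  (forall t, 0 <= t <= 1 -> cdiff U (RtoC t) (V (RtoC t))) ->
  (forall t, 0 <= t <= 1 -> continuous V (RtoC t)) ->
  (forall t, 0 < t < 1 -> O (U (RtoC t))) ->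
  (forall eps, 0 < eps -> exists d, 0 < d /\
     forall z, Cmod z < 1 -> Cmod (z - U (RtoC 0)) < d -> Cmod (G z - la) < eps) ->
  (forall eps, 0 < eps -> exists d, 0 < d /\
     forall z, Cmod z < 1 -> Cmod (z - U (RtoC 1)) < d -> Cmod (G z - lb) < eps) ->
  (forall t, 0 < t < 1 -> (k * (V (RtoC t) * g (U (RtoC t))))%C = h t) ->
  is_RInt_gen (V := C_R_CompleteNormedModule) h (at_right 0) (at_left 1) (k * lb - k * la)%C.
Proof.
  intros HO Hg HG HU HV HUO Hla Hlb Hh.
  assert (HUc : forall t, 0 <= t <= 1 -> continuous (fun s => U (RtoC s)) t).
  { intros t Ht. apply (continuous_comp (V := C_UniformSpace) RtoC U).
    - apply continuous_RtoC.
    - eapply cdiff_continuous. now apply HU. }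
  assert (Hk : forall (F : (R -> Prop) -> Prop) (FF : Filter F) (l : C),
    filterlim (fun t => G (U (RtoC t))) F (locally l) ->
    filterlim (fun t => 0 + k * G (U (RtoC t)))%C F (locally (k * l)%C)).
  { intros F FF l Hl. replace (k * l)%C with (0 + k * l)%C by ring.
    apply (filterlim_comp _ _ _ (fun t => G (U (RtoC t))) (fun y => 0 + k * y)%C
             F (locally l) _ Hl).
    apply (cdiff_continuous (fun y => 0 + k * y)%C l k), cdiff_affine. }
  apply is_RInt_gen_01 with (F := fun T => (0 + k * G (U T))%C)
    (f := fun t => (k * (V (RtoC t) * g (U (RtoC t))))%C); [| |exact Hh| |].
  - intros t Ht. rewrite Cmult_comm.
    apply (cdiff_comp (fun y => 0 + k * y)%C (fun T => G (U T))); [apply cdiff_affine|].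
    apply cdiff_comp; [now apply HG, HUO|apply HU; lra].
  - intros t Ht. apply continuous_Cmult; [apply continuous_const|].
    apply continuous_Cmult.
    + apply (continuous_comp (V := C_UniformSpace) RtoC V); [apply continuous_RtoC|apply HV; lra].
    + apply (continuous_comp (V := C_UniformSpace) (fun s => U (RtoC s)) g).
      * apply HUc. lra.
      * now apply Hg, HUO.
  - apply Hk; [typeclasses eauto|]. apply primitive_path_limit with (U (RtoC 0)).
    + typeclasses eauto.
    + exact Hla.
    + generalize at_right_0_lt_1. apply filter_imp. intros t Ht. now apply HO, HUO.
    + eapply filterlim_filter_le_1; [apply filter_le_within|apply (HUc 0); lra].
  - apply Hk; [typeclasses eauto|]. apply primitive_path_limit with (U (RtoC 1)).
    + typeclasses eauto.
    + exact Hlb.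
    + generalize at_left_1_gt_0. apply filter_imp. intros t Ht. now apply HO, HUO.
    + eapply filterlim_filter_le_1; [apply filter_le_within|apply (HUc 1); lra].
Qed.

(** Strict convexity of the disc, read off from identity [E]: the term [t * (1 - t) * |b - a|^2] is
    the gain over the mean of the squared moduli. *)
Lemma open_segment_in_disc (a b : C) (t : R) :
  Cmod a <= 1 -> Cmod b <= 1 -> a <> b -> 0 < t < 1 -> Cmod (on_seg a b t) < 1.
Proof.
  intros Ha Hb Hab Ht.
  assert (Hd : 0 < Cmod (b - a)).
  { apply Cmod_gt_0, Cminus_eq_contra. congruence. }
  pose proof (Cmod_ge_0 a). pose proof (Cmod_ge_0 b).
  assert (E : Cmod (on_seg a b t) ^ 2 = (1 - t) * Cmod a ^ 2 + t * Cmod b ^ 2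
                - t * (1 - t) * Cmod (b - a) ^ 2).
  { rewrite !Cmod2_alt. destruct a as [a1 a2], b as [b1 b2]. simpl. ring. }
  pose proof (Cmod_ge_0 (on_seg a b t)).
  assert (0 < t * (1 - t)) by nra.
  assert (0 < t * (1 - t) * Cmod (b - a) ^ 2) by (apply Rmult_lt_0_compat; [lra|apply pow_lt; lra]).
  assert (Cmod a ^ 2 <= 1) by nra. assert (Cmod b ^ 2 <= 1) by nra.
  assert (Cmod (on_seg a b t) ^ 2 < 1) by nra. nra.
Qed.

Lemma Re_inv_pos (x : C) : 0 < Re x -> 0 < Re (/ x).
Proof.
  intros H. destruct x as [x y]. simpl in *. apply Rdiv_lt_0_compat; [exact H|].
  rewrite !Rmult_1_r. nra.
Qed.

Lemma Re_pos_neq_0 (x : C) : 0 < Re x -> x <> 0.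
Proof. intros H E. rewrite E in H. simpl in H. lra. Qed.

(* With [w] the principal root of [L b / L a], both paths run in the half plane
   [Re (conj w * (L z / L a)) > 0]: on the segment [L z / L a] is
   [(1 - t) + t w^2], on the arc it is [w / ((1 - t) w + t / w)]. *)
Lemma segment_and_arc_integrals (f : C -> C) (P Q a b : C) (k A : R) :
  let L := fun z => (P * z + Q)%C in
  let N := fun t => (a * b * P + (a + RtoC t * (b - a)) * Q)%C in
  let D := fun t => ((b - RtoC t * (b - a)) * P + Q)%C in
  Cmod a <= 1 -> Cmod b <= 1 -> a <> b -> L a <> 0 -> 0 < Re (Csqrt (L b / L a)) ->
  (forall t, 0 < t < 1 -> Cmod (N t) < Cmod (D t)) ->
  analytic_in_disc f -> 0 <= A -> 0 < k < 1 ->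
  (forall z, in_disc z -> Cmod (f z) <= A * Rpower (1 - Cmod z) (- k)) ->
  exists I,
    is_RInt_gen (V := C_R_CompleteNormedModule)
      (fun t => f (on_seg a b t) / L (on_seg a b t))%C (at_right 0) (at_left 1) I /\
    is_RInt_gen (V := C_R_CompleteNormedModule)
      (fun t => 1 / D t * f (N t / D t))%C (at_right 0) (at_left 1) I.
Proof.
  intros L N D Ha Hb Hab HLa Hw HND Hf HA Hk Hgr.
  set (w := Csqrt (L b / L a)) in *.
  assert (Hww : (w * w)%C = (L b / L a)%C) by apply Csqrt_spec.
  assert (Hw0 : w <> 0) by now apply Re_pos_neq_0.
  assert (HLbE : L b = (w * w * L a)%C) by (rewrite Hww; field; exact HLa).
  assert (HLb : L b <> 0).
  { rewrite HLbE. apply Cmult_neq_0; [|exact HLa]. now apply Cmult_neq_0. }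
  assert (Hba : (b - a)%C <> 0) by (apply Cminus_eq_contra; congruence).
  (* With this normalisation the real part is [Re w] at [a] and [|w|^2 * Re w] at [b], so both ends
     are strictly inside the half plane even when they lie on the circle. *)
  set (al := (Cconj w * P / L a)%C). set (be := (Cconj w * Q / L a)%C).
  assert (Hal : forall z, (al * z + be)%C = (Cconj w * (L z / L a))%C).
  { intros z. unfold al, be, L. field. exact HLa. }
  set (O := half_disc al be).
  set (g := fun z => (f z * / L z)%C).
  assert (HOL : forall z, O z -> L z <> 0).
  { intros z [_ H] E. rewrite Hal, E in H.
    replace (Cconj w * (0 / L a))%C with (RtoC 0) in H by (field; exact HLa).
    simpl in H. lra. }
  assert (HLd : forall z, cdiff L z P).
  { intros z. replace L with (fun y => Q + P * y)%C; [apply cdiff_affine|].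
    apply functional_extensionality. intros y. unfold L. ring. }
  assert (Hgd : forall z, O z -> exists d, cdiff g z d).
  { intros z Hz. destruct (analytic_at_cdiff f z (Hf z (proj1 Hz))) as [d Hd].
    eexists. apply cdiff_mult; [exact Hd|].
    apply cdiff_inv; [apply HLd|now apply HOL]. }
  assert (Hgc : forall z, O z -> continuous g z).
  { intros z Hz. destruct (Hgd z Hz) as [d Hd]. now apply cdiff_continuous with d. }
  assert (Hw2 : 0 < Cmod w ^ 2) by (apply pow_lt, Cmod_gt_0, Hw0).
  assert (Hrea : 0 < Re (al * a + be)).
  { rewrite Hal. replace (Cconj w * (L a / L a))%C with (Cconj w) by (field; exact HLa).
    now rewrite re_conj. }
  assert (Hreb : 0 < Re (al * b + be)).
  { rewrite Hal, HLbE.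
    replace (Cconj w * (w * w * L a / L a))%C with (RtoC (Cmod w ^ 2) * w)%C
      by (rewrite Cmod2_conj; field; exact HLa).
    rewrite re_scal_l. now apply Rmult_lt_0_compat. }
  assert (Hseg : forall t, 0 < t < 1 -> O (on_seg a b t)).
  { intros t Ht. split; [now apply open_segment_in_disc|]. rewrite Re_on_seg. nra. }
  destruct (primitive_exists O g (on_seg a b (/ 2)) (half_disc_open al be)
              (half_disc_exhausted al be) Hgd) as (G & HG & HG').
  { apply Hseg. lra. }
  (* Since [x] is interior to the half plane, the part of the open disc near [x] lies entirely in
     [O]; there [/ L] is bounded, and [g] inherits the growth of [f]. *)
  assert (Hlim : forall x, Cmod x <= 1 -> 0 < Re (al * x + be) -> L x <> 0 ->
    exists l, forall eps, 0 < eps -> exists d, 0 < d /\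
      forall z, Cmod z < 1 -> Cmod (z - x) < d -> Cmod (G z - l) < eps).
  { intros x Hx Hre HLx.
    assert (Hinv : continuous (fun z => / L z)%C x).
    { apply continuous_Cinv; [|exact HLx]. eapply cdiff_continuous. apply HLd. }
    destruct (proj1 (locally_Cmod _ _) (filter_and _ _ (Re_affine_pos_locally al be x Hre)
      (proj1 (filterlim_Cmod _ _ _) Hinv 1 Rlt_0_1))) as (eta & Heta & Hloc).
    set (M := Cmod (/ L x) + 1).
    assert (HM : 0 <= M) by (pose proof (Cmod_ge_0 (/ L x)); unfold M; lra).
    apply (primitive_boundary_limit O g G x (A * M) k eta); auto.
    - now apply Rmult_le_pos.
    - intros z Hz Hzx. destruct (Hloc z Hzx) as [H1 H2]. split; [now split|].
      unfold g. rewrite Cmod_mult.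
      replace (A * M * Rpower (1 - Cmod z) (- k)) with (A * Rpower (1 - Cmod z) (- k) * M) by ring.
      apply Rmult_le_compat; [apply Cmod_ge_0|apply Cmod_ge_0|now apply Hgr|].
      pose proof (Cmod_1_lipschitz (/ L z) (/ L x)). unfold M. lra. }
  destruct (Hlim a Ha Hrea HLa) as [la Hla]. destruct (Hlim b Hb Hreb HLb) as [lb Hlb].
  exists (/ (b - a) * lb - / (b - a) * la)%C. split.
  - apply path_integral with (O := O) (g := g) (G := G)
      (U := fun T => (a + (b - a) * T)%C) (V := fun _ => (b - a)%C); auto.
    + now intros z [].
    + intros t _. apply cdiff_affine.
    + intros t _. apply continuous_const.
    + intros t Ht. replace (a + (b - a) * RtoC t)%C with (on_seg a b t)
        by (unfold on_seg; ring). now apply Hseg.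
    + replace (a + (b - a) * RtoC 0)%C with a by ring. exact Hla.
    + replace (a + (b - a) * RtoC 1)%C with b by ring. exact Hlb.
    + intros t Ht. replace (a + (b - a) * RtoC t)%C with (on_seg a b t)
        by (unfold on_seg; ring).
      unfold g. field. split; [now apply HOL, Hseg|exact Hba].
  (* [N] and [D] extended to a complex parameter, as [cdiff] requires. *)
  - set (NC := fun T : C => ((a * b * P + a * Q) + ((b - a) * Q) * T)%C).
    set (DC := fun T : C => (L b + (- (b - a) * P) * T)%C).
    assert (HN : forall t, NC (RtoC t) = N t) by (intros t; unfold NC, N; ring).
    assert (HD : forall t, DC (RtoC t) = D t) by (intros t; unfold DC, D, L; ring).
    assert (HDw : forall t, D t = (L a * w * (RtoC (1 - t) * w + RtoC t / w))%C).
    { intros t. replace (D t) with (RtoC (1 - t) * L b + RtoC t * L a)%C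
        by (unfold D, L; rewrite RtoC_minus; ring).
      rewrite HLbE. field. exact Hw0. }
    (* Both [w] and [/ w] have positive real part. This gives [D <> 0] on the closed interval,
       whereas the strict inequality [HND] says nothing at 0 and 1. *)
    assert (Hden : forall t, 0 <= t <= 1 -> 0 < Re (RtoC (1 - t) * w + RtoC t / w)).
    { intros t Ht. rewrite Re_plus. unfold Cdiv. rewrite !re_scal_l.
      pose proof (Re_inv_pos w Hw) as Hi. nra. }
    assert (HD0 : forall t, 0 <= t <= 1 -> DC (RtoC t) <> 0).
    { intros t Ht. rewrite HD, HDw. apply Cmult_neq_0; [now apply Cmult_neq_0|].
      now apply Re_pos_neq_0, Hden. }
    assert (HLg : forall t, 0 <= t <= 1 ->
      L (NC (RtoC t) * / DC (RtoC t))%C = (L a * L b / DC (RtoC t))%C).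
    { intros t Ht. specialize (HD0 t Ht). unfold L at 1.
      (* In [P * N + Q * D] the terms in [t] cancel; this constant numerator is also why the
         derivative of the arc has a constant over [D^2]. *)
      replace (L a * L b)%C with (P * NC (RtoC t) + Q * DC (RtoC t))%C
        by (unfold NC, DC, L; ring).
      field. exact HD0. }
    assert (HarcO : forall t, 0 < t < 1 -> O (NC (RtoC t) * / DC (RtoC t))%C).
    { intros t Ht. assert (Ht' : 0 <= t <= 1) by lra. specialize (HD0 t Ht').
      split.
      - rewrite Cmod_mult, Cmod_inv by exact HD0. rewrite HN, HD in *.
        specialize (HND t Ht). apply Cmod_gt_0 in HD0.
        apply Rmult_lt_reg_r with (Cmod (D t)); [exact HD0|].
        rewrite Rmult_assoc, Rinv_l by lra. lra.
      - pose proof (Re_pos_neq_0 _ (Hden t Ht')) as Hz.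
        rewrite Hal, HLg by exact Ht'. rewrite HD, HDw, HLbE.
        replace (Cconj w * (L a * (w * w * L a) /
                 (L a * w * (RtoC (1 - t) * w + RtoC t / w)) / L a))%C
          with (RtoC (Cmod w ^ 2) * / (RtoC (1 - t) * w + RtoC t / w))%C.
        + rewrite re_scal_l. apply Rmult_lt_0_compat; [exact Hw2|].
          now apply Re_inv_pos, Hden.
        + rewrite Cmod2_conj. set (y := (RtoC (1 - t) * w + RtoC t / w)%C) in *.
          field. auto. }
    apply path_integral with (O := O) (g := g) (G := G)
      (U := fun T => (NC T * / DC T)%C)
      (V := fun T => ((b - a) * (L a * L b) * / (DC T * DC T))%C); auto.
    + now intros z [].
    + intros t Ht. specialize (HD0 t Ht).
      replace ((b - a) * (L a * L b) * / (DC (RtoC t) * DC (RtoC t)))%C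
        with (((b - a) * Q) * / DC (RtoC t)
              + NC (RtoC t) * (- (- (b - a) * P) / (DC (RtoC t) * DC (RtoC t))))%C.
      * apply (cdiff_mult NC (fun T => / DC T)%C); [apply cdiff_affine|].
        apply cdiff_inv; [apply cdiff_affine|exact HD0].
      * replace ((b - a) * (L a * L b))%C
          with ((b - a) * Q * DC (RtoC t) + NC (RtoC t) * ((b - a) * P))%C
          by (unfold NC, DC, L; ring).
        field. exact HD0.
    + intros t Ht. specialize (HD0 t Ht).
      assert (HDc : continuous DC (RtoC t)) by (eapply cdiff_continuous; apply cdiff_affine).
      apply continuous_Cmult; [apply continuous_const|].
      apply continuous_Cinv; [now apply continuous_Cmult|now apply Cmult_neq_0].
    + replace (NC (RtoC 0) * / DC (RtoC 0))%C with a; [exact Hla|].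
      replace (NC (RtoC 0)) with (a * L b)%C by (unfold NC, L; ring).
      replace (DC (RtoC 0)) with (L b)%C by (unfold DC; ring). field. exact HLb.
    + replace (NC (RtoC 1) * / DC (RtoC 1))%C with b; [exact Hlb|].
      replace (NC (RtoC 1)) with (b * L a)%C by (unfold NC, L; ring).
      replace (DC (RtoC 1)) with (L a)%C by (unfold DC, L; ring). field. exact HLa.
    + intros t Ht. assert (Ht' : 0 <= t <= 1) by lra.
      unfold g. rewrite HLg by exact Ht'. specialize (HD0 t Ht').
      rewrite HN, HD in *. fold (N t / D t)%C.
      field. auto.
Qed.

(** * From the fixed-point integrals to the theorem *)

Lemma self_map_bound (phi : C -> C) (z : C) :
  real_linear_fractional_self_map phi -> in_disc z -> Cmod (phi z) <= 1.
Proof.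
  intros [_ [[_ H]|(k & Hk & H)]] Hz.
  - left. now apply H.
  - rewrite (H z Hz), Cmod_R. apply Rabs_le. lra.
Qed.

Lemma Rpower_exponent_le (x c k : R) : 0 < x <= 1 -> c <= k -> Rpower x (- c) <= Rpower x (- k).
Proof.
  intros Hx Hck. unfold Rpower. apply exp_monotone.
  assert (ln x <= 0) by (rewrite <- ln_1; apply ln_le; lra). nra.
Qed.

Lemma clear_num_0_or_1 (p q : C -> C) (z : C) : clear_num p q z = 0 \/ clear_num p q z = 1.
Proof.
  unfold clear_num. replace (z - z)%C with (RtoC 0) by ring.
  destruct (clear_exp p q z); [now right|left]. simpl. ring.
Qed.

(** [integral01] has some value even for a divergent integral, so convergence is established along
    with the equality. *)
Lemma converges01_intro (u v : R -> C) (I : C) :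
  is_RInt_gen (V := C_R_CompleteNormedModule) u (at_right 0) (at_left 1) I ->
  is_RInt_gen (V := C_R_CompleteNormedModule) v (at_right 0) (at_left 1) I ->
  converges01 u /\ converges01 v /\ integral01 u = integral01 v.
Proof.
  intros Hu Hv. split; [now exists I|]. split; [now exists I|].
  unfold integral01. transitivity I; [|symmetry];
    apply (is_RInt_gen_unique (V := C_R_CompleteNormedModule)); assumption.
Qed.

Theorem proposition2
  (phi1 phi2 p q : C -> C)
  (Hphi1 : real_linear_fractional_self_map phi1)
  (Hphi2 : real_linear_fractional_self_map phi2)
  (Hphi12 : exists z, in_disc z /\ phi1 z <> phi2 z)
  (Hp : meromorphic_in_disc p)
  (Hq : meromorphic_in_disc q)
  (Hroot : forall z, in_disc z ->
     lin_at p q z (phi1 z) <> 0 /\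
     0 < Re (Csqrt (lin_at p q z (phi2 z) / lin_at p q z (phi1 z))%C))
  (Hgamma : forall (t : R) (z : C), 0 < t < 1 -> in_disc z ->
     Cmod (gamma_num phi1 phi2 p q t z) < Cmod (gamma_den phi1 phi2 p q t z))
  (X : CompleteNormedModule C_AbsRing) (ev : X -> C -> C)
  (HX : analytic_function_space X ev)
  (c K : R) (Hc : c < 1) (HK : 0 < K)
  (Hgrowth : forall (f : X) (z : C), in_disc z ->
     Cmod (ev f z) <= K * Rpower (1 - Cmod z) (- c) * norm f) :
  forall (f : X) (z : C), in_disc z ->
    converges01 (I_integrand phi1 phi2 p q (ev f) z) /\
    converges01 (fun t => T_op phi1 phi2 p q t (ev f) z) /\
    I_op phi1 phi2 p q (ev f) z
    = integral01 (fun t => T_op phi1 phi2 p q t (ev f) z).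
Proof.
  intros f z Hz. destruct (Hroot z Hz) as [HLa Hw].
  (* When the clearing exponent is positive, the factor [(z - z)^m] is 0 and both integrands vanish
     identically. *)
  destruct (clear_num_0_or_1 p q z) as [E|E].
  { apply converges01_intro with (RtoC 0); apply is_RInt_gen_01_const; intros t _.
    - unfold I_integrand. rewrite E. unfold Cdiv. now rewrite !Cmult_0_l.
    - unfold T_op, weight. rewrite E. unfold Cdiv. now rewrite !Cmult_0_l. }
  (* Without a segment, [L] has one value along the path, [gamma] stays at [phi1 z], and both
     integrands are the same constant. *)
  destruct (classic (phi1 z = phi2 z)) as [Eab|Hab].
  { apply converges01_intro with (ev f (phi1 z) / lin_at p q z (phi1 z))%C;
      apply is_RInt_gen_01_const; intros t _.
    - unfold I_integrand, r_path, seg. rewrite E, <- Eab.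
      replace (phi1 z + RtoC t * (phi1 z - phi1 z))%C with (phi1 z) by ring.
      now rewrite Cmult_1_l.
    - unfold T_op, weight, gamma.
      assert (ED : gamma_den phi1 phi2 p q t z = lin_at p q z (phi1 z)).
      { unfold gamma_den, lin_at, seg. rewrite <- Eab. ring. }
      assert (EN : gamma_num phi1 phi2 p q t z = (phi1 z * lin_at p q z (phi1 z))%C).
      { unfold gamma_num, lin_at, seg. rewrite <- Eab. ring. }
      rewrite ED, EN, E.
      replace (phi1 z * lin_at p q z (phi1 z) / lin_at p q z (phi1 z))%C with (phi1 z)
        by (field; exact HLa).
      field. exact HLa. }
  (* The given [c] may be zero or negative, while the boundary estimate wants an exponent in (0, 1).
     Raising it only weakens the growth bound, as [1 - |y| <= 1]; any number of (0, 1) could replace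
     [/ 2]. *)
  set (k := Rmax c (/ 2)).
  assert (Hk : 0 < k < 1).
  { split; [|apply Rmax_lub_lt; lra]. apply Rlt_le_trans with (/ 2); [lra|apply Rmax_r]. }
  destruct (segment_and_arc_integrals (ev f) (pval p q z) (qval p q z) (phi1 z) (phi2 z)
              k (K * norm f)) as (I & HI1 & HI2); auto.
  - now apply self_map_bound.
  - now apply self_map_bound.
  - intros t Ht. now apply Hgamma.
  - apply HX.
  - apply Rmult_le_pos; [lra|apply norm_ge_0].
  - intros y Hy. eapply Rle_trans; [now apply Hgrowth|].
    replace (K * norm f * Rpower (1 - Cmod y) (- k))
      with (K * Rpower (1 - Cmod y) (- k) * norm f) by ring.
    apply Rmult_le_compat_r; [apply norm_ge_0|]. apply Rmult_le_compat_l; [lra|].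
    pose proof (Cmod_ge_0 y). unfold in_disc in Hy.
    apply Rpower_exponent_le; [lra|apply Rmax_l].
  - apply converges01_intro with I.
    + eapply is_RInt_gen_ext; [|exact HI1]. apply filter_forall. intros xy t _.
      unfold I_integrand. rewrite E, Cmult_1_l. reflexivity.
    + eapply is_RInt_gen_ext; [|exact HI2]. apply filter_forall. intros xy t _.
      unfold T_op, weight. now rewrite E.
Qed.
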